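(* For all integers $n\ge 0$, \begin{align*} B_5(4n+3)&\equiv 0\pmod{10},\\ B_5(5n+2)&\equiv B_5(5n+3)\equiv B_5(5n+4)\equiv 0\pmod{5},\\ B_5(20n+7)&\equiv B_5(20n+19)\equiv 0\pmod{100}. \end{align*}
   Context: $B_5(n)$ denotes the 5-regular bipartition function, i.e. the integers $B_5(n)$, $n\ge 0$, defined by the generating function $$\sum_{n=0}^{\infty}B_5(n)q^n = \frac{(q^5;q^5)^2_{\infty}}{(q;q)^2_{\infty}},$$ where $(q^a;q^b)_{\infty} := \prod_{m=0}^{\infty}(1-q^{bm+a})$. *)

(* Defs.v *)
From mathcomp Require Import all_boot all_order all_algebra.

Set Implicit Arguments.
Unset Strict Implicit.
Unset Printing Implicit Defensive.

Import GRing.Theory.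
Local Open Scope ring_scope.

(* A formal power series in q over the integers, as its coefficient sequence. *)
Definition fps : Type := nat -> int.

Definition fps_mul (f g : fps) : fps :=
  fun n => \sum_(i < n.+1) f i * g (n - i)%N.

(* The first n coefficients of f / g, by the usual recursion.                 *)
Fixpoint fps_div_seq (f g : fps) (n : nat) : seq int :=
  if n is m.+1 then
    let s := fps_div_seq f g m in
    rcons s ((g 0%N)^-1 * (f m - \sum_(i < m) s`_i * g (m - i)%N))
  else [::].

(* The quotient f / g, meaningful when g 0 is a unit: see fps_divK and        *)
(* fps_div_unique.                                                            *)
Definition fps_div (f g : fps) : fps := fun n => (fps_div_seq f g n.+1)`_n.

(* (q^a; q^b)_oo for b > 0.  A factor 1 - q^(b m + a) with m > n does not     *)
(* affect the coefficient of q^n, so that coefficient of the infinite product *)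
(* is that of every partial product with more than n factors: see qpochP.     *)
Definition qpoch (a b : nat) : fps :=
  fun n => (\prod_(m < n.+1) (1 - 'X^(b * m + a)) : {poly int})`_n.

Definition B5 : fps :=
  fps_div (fps_mul (qpoch 5 5) (qpoch 5 5)) (fps_mul (qpoch 1 1) (qpoch 1 1)).

Lemma size_fps_div_seq f g n : size (fps_div_seq f g n) = n.
Proof. by elim: n => //= n IHn; rewrite size_rcons IHn. Qed.

Lemma nth_fps_div_seq f g n i :
  (i < n)%N -> (fps_div_seq f g n)`_i = fps_div f g i.
Proof.
elim: n => // n IHn; rewrite ltnS leq_eqVlt => /predU1P[-> //|ltin] /=.
by rewrite nth_rcons size_fps_div_seq ltin IHn.
Qed.

Lemma fps_divE f g n :
  fps_div f g n =
    (g 0%N)^-1 * (f n - \sum_(i < n) fps_div f g i * g (n - i)%N).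
Proof.
rewrite {1}/fps_div /= nth_rcons size_fps_div_seq ltnn eqxx.
by congr (_ * (_ - _)); apply: eq_bigr => i _; rewrite nth_fps_div_seq.
Qed.

Lemma fps_divK f g :
  g 0%N \is a GRing.unit -> fps_mul (fps_div f g) g =1 f.
Proof.
move=> Ug n; rewrite /fps_mul big_ord_recr /= subnn (fps_divE f g n).
by rewrite mulrAC mulVr // mul1r addrC subrK.
Qed.

Lemma fps_div_unique f g h :
  g 0%N \is a GRing.unit -> fps_mul h g =1 f -> h =1 fps_div f g.
Proof.
move=> Ug hgf n; elim/ltn_ind: n => n IHn.
rewrite fps_divE -hgf /fps_mul big_ord_recr /= subnn.
under [in RHS]eq_bigr => i _ do rewrite -?IHn //.
under [X in _ - X]eq_bigr => i _ do rewrite -(IHn i (ltn_ord i)).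
by rewrite addrAC subrr add0r mulrC mulrK.
Qed.

Lemma qpochP a b n M : (0 < b)%N -> (n < M)%N ->
  (\prod_(m < M) (1 - 'X^(b * m + a)) : {poly int})`_n = qpoch a b n.
Proof.
move=> b_gt0; elim: M => // M IHM; rewrite ltnS leq_eqVlt => /predU1P[-> //|ltnM].
rewrite big_ord_recr /= mulrBr mulr1 coefB coefMXn.
suff -> : (n < b * M + a)%N by rewrite subr0 IHM.
by rewrite (leq_trans ltnM) // (leq_trans _ (leq_addr _ _)) // leq_pmull.
Qed.

Lemma qpoch_sqr11_0 : fps_mul (qpoch 1 1) (qpoch 1 1) 0%N = 1.
Proof.
rewrite /fps_mul big_ord1 /qpoch !big_ord1 muln0 add0n expr1.
by rewrite coefB coef1 coefX subr0 mulr1.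
Qed.

Lemma B5_genfun :
  fps_mul B5 (fps_mul (qpoch 1 1) (qpoch 1 1))
    =1 fps_mul (qpoch 5 5) (qpoch 5 5).
Proof. by apply: fps_divK; rewrite qpoch_sqr11_0 unitr1. Qed.

(* Main.v *)
Require Import Defs.
From HB Require Import structures.
From mathcomp Require Import all_boot all_order all_algebra.
From mathcomp Require Import boolp classical_sets fsbigop.
From mathcomp Require Import zify ring.

(** Write f_k for the Euler product (q^k; q^k)_oo and g = f_5 / f_1, so that
    the generating function of B5 is g^2.

    Modulo 25.  From (1 - x)^5 = 1 - x^5 modulo 5, X = f_5 / f_1^5 is congruent
    to 1 modulo 5, hence X^2 = 2 X - 1 modulo 25, and multiplying by f_1^8
        B5 = 2 f_1^3 f_5 - f_1^8    modulo 25   ([B5_mod25]).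
    The exponents of f_1^8 miss the class of 3 modulo 4 ([euler8_4n3]).  By
    Jacobi, 2 f_1^3 is the sum of (-1)^j (1 - 2 j) q^(j (j - 1) / 2) over the
    integers j, so f_1^3, and with it f_1^3 f_5, has no exponent in the classes
    of 2 and 4 modulo 5, while in the class of 3 the coefficients are multiples
    of 5.  This gives all the divisibility by 5 and by 25.

    Modulo 4.  Write g = a(q^2) + q b(q^2).  The coefficients of B5 at odd
    indices are those of 2 a b.  Modulo 2 the series f_1^3 f_5 and f_1 f_5^3 are
    sums over lattice points on which an involution acts, so that only the fixed
    points count; this determines half of each
    ([sec0_cube_pentagonal], [sec1_pentagonal_cube]), and these two halves give
    a = f_2 and b = f_10 g, so a b = f_1 f_5^3 ([sec_reg5_mod2]).  The exponents
    of f_1 are pentagonal numbers, never 3 or 4 modulo 5.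

    All theta expansions come from the Jacobi triple product
    ([jacobi_triple]), obtained from the finite q-binomial theorem by letting the
    number of factors grow; the cube formula is the derivative of the same finite
    identity at its trivial zero ([jacobi_cube]).  The vanishing for f_1^8 follows
    from f_1^2 = f_2 phi(-q), with phi the theta series of the squares, and the
    dissection of phi(-q)^2 by the parity of x + y in x^2 + y^2
    ([theta_square], [psi_square]). *)

Set Implicit Arguments.
Unset Strict Implicit.
Unset Printing Implicit Defensive.

Import GRing.Theory.
Local Open Scope ring_scope.

(** * The ring of formal power series *)

Definition pser (R : Type) : Type := nat -> R.

HB.instance Definition _ (R : Type) := gen_eqMixin (pser R).
HB.instance Definition _ (R : Type) := gen_choiceMixin (pser R).

Section SeriesRing.
Variable R : comNzRingType.
Implicit Types f g h : pser R.

Definition ps_add f g : pser R := fun n => f n + g n.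
Definition ps_opp f : pser R := fun n => - f n.
Definition ps_mul f g : pser R := fun n => \sum_(i < n.+1) f i * g (n - i)%N.
Definition psC (c : R) : pser R := fun n => if n == 0%N then c else 0.

Lemma ps_addA : associative ps_add.
Proof. by move=> f g h; apply/funext => n; apply: addrA. Qed.
Lemma ps_addC : commutative ps_add.
Proof. by move=> f g; apply/funext => n; apply: addrC. Qed.
Lemma ps_add0 : left_id (fun=> 0) ps_add.
Proof. by move=> f; apply/funext => n; apply: add0r. Qed.
Lemma ps_addN : left_inverse (fun=> 0) ps_opp ps_add.
Proof. by move=> f; apply/funext => n; apply: addNr. Qed.

HB.instance Definition _ :=
  GRing.isZmodule.Build (pser R) ps_addA ps_addC ps_add0 ps_addN.

(** A coefficient of a product only depends on truncations of the factors, so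
    the ring laws are those of polynomials. *)
Let trunc n f : {poly R} := \poly_(i < n.+1) f i.

Let ps_mul_trunc f g n m :
  (m <= n)%N -> ps_mul f g m = (trunc n f * trunc n g)`_m.
Proof.
move=> lemn; rewrite coefM; apply: eq_bigr => i _.
by rewrite !coef_poly !ltnS (leq_trans _ lemn) ?(leq_trans (leq_subr _ _)) ?leq_ord.
Qed.

Lemma ps_mulA : associative ps_mul.
Proof.
move=> f g h; apply/funext => n.
transitivity ((trunc n f * trunc n g * trunc n h)`_n).
  rewrite -mulrA coefM; apply: eq_bigr => i _.
  by rewrite coef_poly ltnS leq_ord (ps_mul_trunc _ _ (leq_subr i n)).
rewrite coefM; apply: eq_bigr => i _.
by rewrite coef_poly ltnS leq_subr (ps_mul_trunc _ _ (leq_ord i)).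
Qed.
Lemma ps_mulC : commutative ps_mul.
Proof.
move=> f g; apply/funext => n.
by rewrite !(ps_mul_trunc _ _ (leqnn n)) mulrC.
Qed.
Lemma ps_mul1 : left_id (psC 1) ps_mul.
Proof.
move=> f; apply/funext => n; rewrite /ps_mul big_ord_recl /= /psC /= mul1r subn0.
by rewrite big1 ?addr0 // => i _; rewrite mul0r.
Qed.
Lemma ps_mulDl : left_distributive ps_mul +%R.
Proof.
move=> f g h; apply/funext => n; apply: etrans (big_split _ _ _ _ _).
by apply: eq_bigr => i _; apply: mulrDl.
Qed.
Lemma ps_oner_neq0 : psC 1 != 0.
Proof. by apply/eqP => /(congr1 (@^~ 0%N)) /eqP; rewrite /psC /= oner_eq0. Qed.

HB.instance Definition _ := GRing.Zmodule_isComNzRing.Build (pser R)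
  ps_mulA ps_mulC ps_mul1 ps_mulDl ps_oner_neq0.

Lemma coefpsD f g n : (f + g) n = f n + g n. Proof. by []. Qed.
Lemma coefpsN f n : (- f) n = - f n. Proof. by []. Qed.
Lemma coefpsB f g n : (f - g) n = f n - g n. Proof. by []. Qed.
Lemma coefps1 n : (1 : pser R) n = (n == 0%N)%:R.
Proof. by rewrite /GRing.one /= /psC; case: eqP. Qed.
Lemma coefpsM f g n : (f * g) n = \sum_(i < n.+1) f i * g (n - i)%N.
Proof. by []. Qed.
Lemma coefpsMn f k n : (f *+ k) n = f n *+ k.
Proof. by elim: k => // k IHk; rewrite !mulrS coefpsD IHk. Qed.
Lemma coefps_sum (I : Type) (r : seq I) (P : pred I) (F : I -> pser R) n :
  (\sum_(i <- r | P i) F i) n = \sum_(i <- r | P i) F i n.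
Proof. by elim/big_rec2: _ => // i x y _ <-. Qed.

Lemma psC_is_zmod : zmod_morphism psC.
Proof.
by move=> a b; apply/funext => n; rewrite coefpsB /psC; case: eqP; rewrite ?subr0.
Qed.
Lemma psC_is_mul : monoid_morphism psC.
Proof.
split=> // a b; apply/funext => n; rewrite coefpsM big_ord_recl subn0 big1 /=.
  by rewrite addr0 /psC; case: eqP; rewrite ?mulr0.
by move=> i _; rewrite mul0r.
Qed.
HB.instance Definition _ := GRing.isZmodMorphism.Build R (pser R) psC psC_is_zmod.
HB.instance Definition _ := GRing.isMonoidMorphism.Build R (pser R) psC psC_is_mul.

Definition psX : pser R := fun n => (n == 1%N)%:R.

Lemma coefpsXM f n : (psX * f) n = if n is m.+1 then f m else 0.
Proof.
rewrite coefpsM; case: n => [|n]; first by rewrite big_ord1 mul0r.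
rewrite big_ord_recl mul0r add0r big_ord_recl mul1r subSS subn0.
by rewrite big1 ?addr0 // => i _; rewrite mul0r.
Qed.

Lemma coefpsXnM k f n : (psX ^+ k * f) n = if (k <= n)%N then f (n - k)%N else 0.
Proof.
elim: k n => [|k IHk] n; first by rewrite mul1r subn0.
by rewrite exprS -mulrA coefpsXM; case: n => // n; rewrite IHk.
Qed.

Lemma coefpsCM c f n : (psC c * f) n = c * f n.
Proof.
by rewrite coefpsM big_ord_recl subn0 big1 /= ?addr0 // => i _; rewrite mul0r.
Qed.

Lemma coefpsCXn c k n : (psC c * psX ^+ k) n = if n == k then c else 0.
Proof.
rewrite coefpsCM -[psX ^+ k]mulr1 coefpsXnM coefps1 subn_eq0 eqn_leq andbC.
by case: leqP => _; rewrite ?mulr0 // mulr_natr mulrb.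
Qed.

Lemma coefpsXn k n : (psX ^+ k) n = (n == k)%:R.
Proof. by rewrite -[psX ^+ k]mul1r -[1](rmorph1 psC) coefpsCXn; case: eqP. Qed.

Lemma psXn_inj k : injective ( *%R (psX ^+ k)).
Proof.
move=> f g /(congr1 (fun h : pser R => h (k + _)%N)) efg; apply/funext => n.
by have := efg n; rewrite !coefpsXnM leq_addr addKn.
Qed.
End SeriesRing.
Arguments psX {R}.
Arguments psC {R} c.

(** * Dilation and sections *)

Section Dilation.
Variable R : comNzRingType.
Implicit Types f g : pser R.

(** The substitution of q^k for q.  Writing [k.-1.+1] for k makes it a ring
    morphism for every k, the junk value at 0 being that at 1. *)
Definition dil (k : nat) f : pser R :=
  fun n => if (k.-1.+1 %| n)%N then f (n %/ k.-1.+1)%N else 0.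
(** The Atkin operator: the coefficients at the indices r modulo m. *)
Definition sec (m r : nat) f : pser R := fun n => f (m * n + r)%N.

Lemma coef_dil k f n : (0 < k)%N ->
  dil k f n = if (k %| n)%N then f (n %/ k)%N else 0.
Proof. by case: k. Qed.

Lemma coef_dil_mul k f n : (0 < k)%N -> dil k f (k * n)%N = f n.
Proof. by move=> k_gt0; rewrite coef_dil // dvdn_mulr // mulKn. Qed.

Lemma sum_dvdn_ord k r n (F : nat -> R) : (r < k)%N ->
  \sum_(i < (k * n + r).+1 | (k %| i)%N) F i = \sum_(j < n.+1) F (k * j)%N.
Proof.
move=> ltrk; have k_gt0 : (0 < k)%N by apply: leq_ltn_trans ltrk.
rewrite -(big_mkord xpredT (fun j => F (k * j)%N)).
rewrite -(big_mkord (fun i => k %| i)%N).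
rewrite -big_filter -(big_map (muln k) xpredT F); apply: perm_big.
apply: uniq_perm; first by rewrite filter_uniq ?iota_uniq.
  by rewrite map_inj_uniq ?iota_uniq // => i j /eqP; rewrite eqn_pmul2l // => /eqP.
move=> i; rewrite mem_filter mem_index_iota; apply/andP/mapP.
  case=> /dvdnP[j ->]; rewrite mulnC ltnS => lej; exists j => //.
  rewrite mem_index_iota /= -(ltn_pmul2l k_gt0) mulnS.
  by rewrite (leq_ltn_trans lej) // addnC ltn_add2r.
case=> j; rewrite mem_index_iota /= => ltj ->; split; first exact: dvdn_mulr.
by rewrite ltnS (leq_trans _ (leq_addr _ _)) // leq_pmul2l.
Qed.

(** Sections are linear over the series in q^m; this is what makes dissections
    computable. *)
Lemma sec_dilM m r f g : (r < m)%N -> sec m r (dil m g * f) = g * sec m r f.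
Proof.
move=> ltrm; have m_gt0 : (0 < m)%N by apply: leq_ltn_trans ltrm.
apply/funext => n; rewrite /sec !coefpsM.
pose F i := g (i %/ m)%N * f (m * n + r - i)%N.
transitivity (\sum_(i < (m * n + r).+1 | (m %| i)%N) F i).
  rewrite [RHS]big_mkcond /=; apply: eq_bigr => i _; rewrite coef_dil //.
  by case: ifP; rewrite ?mul0r.
rewrite sum_dvdn_ord //; apply: eq_bigr => j _; rewrite /F mulKn //.
by rewrite mulnBr addnBAC // leq_pmul2l // leq_ord.
Qed.

Lemma sec_inj m f g : (0 < m)%N ->
  (forall r, (r < m)%N -> sec m r f = sec m r g) -> f = g.
Proof.
move=> m_gt0 efg; apply/funext => n.
have := congr1 (@^~ (n %/ m)%N) (efg (n %% m)%N (ltn_pmod n m_gt0)).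
by rewrite /sec mulnC -divn_eq.
Qed.

Lemma sec_dil m r f : (0 < m)%N ->
  (r < m)%N -> sec m r (dil m f) = if r == 0%N then f else 0.
Proof.
move=> m_gt0 ltrm; apply/funext => n; rewrite /sec coef_dil //.
rewrite dvdn_addr ?dvdn_mulr //; case: (posnP r) => [->|r_gt0].
  by rewrite dvdn0 addn0 mulKn.
by rewrite gtnNdvd // -(negbK (r == 0%N)) -lt0n r_gt0.
Qed.

Lemma dil_is_zmod k : zmod_morphism (dil k).
Proof.
by move=> f g; apply/funext => n; rewrite coefpsB /dil; case: ifP; rewrite ?subr0.
Qed.
Lemma dil_is_mul k : monoid_morphism (dil k).
Proof.
split=> [|f g].
  apply/funext => n; rewrite /dil !coefps1; case: ifPn => [/dvdnP[j ->]|ndvd].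
    by rewrite mulnK // muln_eq0 orbF.
  by case: eqP ndvd => // ->; rewrite dvdn0.
apply: (@sec_inj k.-1.+1) => // r ltrk.
have -> : dil k = dil k.-1.+1 by [].
by rewrite sec_dilM // !sec_dil //; case: eqP; rewrite ?mulr0.
Qed.
HB.instance Definition _ k :=
  GRing.isZmodMorphism.Build (pser R) (pser R) (dil k) (dil_is_zmod k).
HB.instance Definition _ k :=
  GRing.isMonoidMorphism.Build (pser R) (pser R) (dil k) (dil_is_mul k).

Lemma secD m r f g : sec m r (f + g) = sec m r f + sec m r g.
Proof. by []. Qed.

Lemma dil_psC k c : dil k (psC c) = psC c.
Proof.
apply/funext => n; rewrite /dil /psC; case: ifPn => [/dvdnP[j ->]|ndvd].
  by rewrite mulnK // muln_eq0 orbF.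
by case: eqP ndvd => // ->; rewrite dvdn0.
Qed.

Lemma dil_psX k : (0 < k)%N -> dil k psX = psX ^+ k.
Proof.
move=> k_gt0; apply/funext => n.
rewrite coef_dil // coefpsXn /psX; case: ifPn => [/dvdnP[j ->]|ndvd].
  by rewrite mulnK // -[X in (_ * _)%N == X]mul1n eqn_pmul2r.
by case: eqP ndvd => // ->; rewrite dvdnn.
Qed.

End Dilation.

(** * Truncated equality, coefficient maps and infinite products *)

Section Truncation.
Variable R : comNzRingType.
Implicit Types f g u : pser R.

Definition eqX N f g := forall n, (n < N)%N -> f n = g n.

Lemma eqX_all f g : (forall N, eqX N f g) -> f = g.
Proof. by move=> efg; apply/funext => n; apply: (efg n.+1). Qed.
Lemma eqX_refl N f : eqX N f f. Proof. by []. Qed.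
Lemma eqX_sym N f g : eqX N f g -> eqX N g f.
Proof. by move=> efg n ltnN; rewrite efg. Qed.
Lemma eqX_trans N g f h : eqX N f g -> eqX N g h -> eqX N f h.
Proof. by move=> efg egh n ltnN; rewrite efg ?egh. Qed.
Lemma eqX_le M N f g : (M <= N)%N -> eqX N f g -> eqX M f g.
Proof. by move=> leMN efg n ltnM; apply: efg; apply: leq_trans leMN. Qed.

Lemma eqXD N f f' g g' : eqX N f f' -> eqX N g g' -> eqX N (f + g) (f' + g').
Proof. by move=> ef eg n ltnN; rewrite !coefpsD ef ?eg. Qed.
Lemma eqXM N f f' g g' : eqX N f f' -> eqX N g g' -> eqX N (f * g) (f' * g').
Proof.
move=> ef eg n ltnN; rewrite !coefpsM; apply: eq_bigr => i _.
by rewrite ef ?eg ?(leq_ltn_trans (leq_subr _ _)) // (leq_ltn_trans (leq_ord i)).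
Qed.
Lemma eqX_exp N k f g : eqX N f g -> eqX N (f ^+ k) (g ^+ k).
Proof. by move=> efg; elim: k => // k IHk; rewrite !exprS; apply: eqXM. Qed.
Lemma eqX_sum N (I : Type) (r : seq I) (P : pred I) (F G : I -> pser R) :
  (forall i, P i -> eqX N (F i) (G i)) ->
  eqX N (\sum_(i <- r | P i) F i) (\sum_(i <- r | P i) G i).
Proof. by move=> eFG; elim/big_ind2: _ => // *; apply: eqXD. Qed.
Lemma eqX_prod N (I : Type) (r : seq I) (P : pred I) (F G : I -> pser R) :
  (forall i, P i -> eqX N (F i) (G i)) ->
  eqX N (\prod_(i <- r | P i) F i) (\prod_(i <- r | P i) G i).
Proof. by move=> eFG; elim/big_ind2: _ => // *; apply: eqXM. Qed.

Lemma eqX_XnM N k f g : eqX N f g -> eqX (k + N) (psX ^+ k * f) (psX ^+ k * g).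
Proof.
move=> efg n ltn; rewrite !coefpsXnM; case: leqP => // lekn; apply: efg.
by rewrite ltn_subLR.
Qed.
(** A series with constant coefficient 1 is a unit, so it cancels at every
    precision. *)
Lemma eqX_cancel N u f g : u 0%N = 1 -> eqX N (u * f) (u * g) -> eqX N f g.
Proof.
move=> u0 eufg; elim/ltn_ind => n IHn ltnN; have := eufg n ltnN.
rewrite !coefpsM !big_ord_recl u0 !mul1r !subn0.
rewrite [X in _ + X = _](_ : _ = \sum_(i < n)
          u (bump 0 i) * g (n - bump 0 i)%N); first exact: addIr.
apply: eq_bigr => i _; rewrite /= /bump add1n IHn //.
  by have := ltn_ord i; lia.
exact: leq_ltn_trans (leq_subr _ _) ltnN.
Qed.

Lemma pser_mulI u f g : u 0%N = 1 -> u * f = u * g -> f = g.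
Proof.
by move=> u0 e; apply: eqX_all => N; apply: (@eqX_cancel N u) => //; rewrite e.
Qed.

Lemma eqX_dil N k f g : eqX N f g -> eqX N (dil k f) (dil k g).
Proof.
move=> efg n ltnN; rewrite /dil; case: ifP => // _; apply: efg.
exact: leq_ltn_trans (leq_div _ _) ltnN.
Qed.
End Truncation.

Section CoefMap.
Variables (R S : comNzRingType) (phi : {rmorphism R -> S}).
Definition smap (f : pser R) : pser S := fun n => phi (f n).
Lemma smap_is_zmod : zmod_morphism smap.
Proof. by move=> f g; apply/funext => n; apply: rmorphB. Qed.
Lemma smap_is_mul : monoid_morphism smap.
Proof.
split=> [|f g]; apply/funext => n; first by rewrite /smap !coefps1 rmorph_nat.
rewrite /smap !coefpsM rmorph_sum; apply: eq_bigr => i _; exact: rmorphM.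
Qed.
HB.instance Definition _ :=
  GRing.isZmodMorphism.Build (pser R) (pser S) smap smap_is_zmod.
HB.instance Definition _ :=
  GRing.isMonoidMorphism.Build (pser R) (pser S) smap smap_is_mul.
Lemma smap_psC c : smap (psC c) = psC (phi c).
Proof. by apply/funext => n; rewrite /smap /psC; case: eqP => // _; apply: rmorph0. Qed.
Lemma smap_psX : smap psX = psX.
Proof. by apply/funext => n; rewrite /smap /psX rmorph_nat. Qed.
End CoefMap.

Section PolySeries.
Variable R : comNzRingType.
Definition ps_of_poly (p : {poly R}) : pser R := fun n => p`_n.
Lemma ps_of_poly_is_zmod : zmod_morphism ps_of_poly.
Proof. by move=> p r; apply/funext => n; apply: coefB. Qed.
Lemma ps_of_poly_is_mul : monoid_morphism ps_of_poly.
Proof.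
split=> [|p r]; apply/funext => n; first by rewrite coefps1 /ps_of_poly coef1.
exact: coefM.
Qed.
HB.instance Definition _ :=
  GRing.isZmodMorphism.Build {poly R} (pser R) ps_of_poly ps_of_poly_is_zmod.
HB.instance Definition _ :=
  GRing.isMonoidMorphism.Build {poly R} (pser R) ps_of_poly ps_of_poly_is_mul.
Lemma ps_of_polyXn k : ps_of_poly 'X^k = psX ^+ k.
Proof. by apply/funext => n; rewrite /ps_of_poly coefXn coefpsXn. Qed.
End PolySeries.

Section QProducts.
Variable R : comNzRingType.
Implicit Types (c : R) (s a k : nat).

Definition qfac c s a i : pser R := 1 + psC c * psX ^+ (a * i + s).
(** The product (- c q^s; q^a)_oo.  For a > 0 the factors of index above n do
    not reach the coefficient of q^n, see [qprodE]. *)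
Definition qprod c s a : pser R := fun n => (\prod_(i < n.+1) qfac c s a i) n.
Definition euler k : pser R := qprod (-1) k k.

Lemma qfac_big c s a i N : (N <= a * i + s)%N -> eqX N (qfac c s a i) 1.
Proof.
move=> leN n ltnN; rewrite /qfac coefpsD coefpsCXn.
by rewrite (ltn_eqF (leq_trans ltnN leN)) addr0.
Qed.

Lemma qprodE N M c s a : (0 < a)%N -> (N <= M)%N ->
  eqX N (qprod c s a) (\prod_(i < M) qfac c s a i).
Proof.
move=> a_gt0 leNM n /leq_trans/(_ leNM); rewrite /qprod; clear N leNM.
elim: M => // M IHM; rewrite ltnS leq_eqVlt => /predU1P[-> //|ltnM].
rewrite IHM // big_ord_recr /= -[X in X n = _]mulr1.
apply: (@eqXM _ M) => //; apply/eqX_sym/qfac_big.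
by rewrite (leq_trans (leq_pmull _ a_gt0)) ?leq_addr.
Qed.

Lemma qprod0 c s a : (0 < s)%N -> qprod c s a 0%N = 1.
Proof.
move=> s_gt0; rewrite /qprod big_ord1; apply: (@qfac_big c s a 0 1) => //.
by rewrite muln0.
Qed.

(** Sort the factors by their index modulo k. *)
Lemma qprod_split k c s a : (0 < a)%N -> (0 < k)%N ->
  qprod c s a = \prod_(r < k) qprod c (a * r + s) (a * k).
Proof.
move=> a_gt0 k_gt0; apply: eqX_all => N; have ak_gt0 : (0 < a * k)%N by lia.
apply: (@eqX_trans _ _ (\prod_(i < N * k) qfac c s a i)).
  by apply: qprodE => //; apply: leq_pmulr.
apply: eqX_sym.
apply: (@eqX_trans _ _ (\prod_(r < k) \prod_(i < N) qfac c (a * r + s) (a * k) i)).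
  by apply: eqX_prod => r _; apply: qprodE.
rewrite -(big_mkord xpredT (qfac c s a)) big_nat_mul big_mkord exchange_big /=.
move=> n _; congr (_ n); apply: eq_bigr => j _.
rewrite -[X in index_iota X _]add0n big_addn big_mkord mulSn addnK.
by apply: eq_bigr => r _; rewrite /qfac; congr (1 + psC c * psX ^+ _); ring.
Qed.

Lemma dil_qprod k c s a : (0 < a)%N -> (0 < k)%N ->
  dil k (qprod c s a) = qprod c (k * s) (k * a).
Proof.
move=> a_gt0 k_gt0; apply: eqX_all => N.
apply: (@eqX_trans _ _ (\prod_(i < N) qfac c (k * s) (k * a) i)); last first.
  by apply/eqX_sym/qprodE => //; rewrite muln_gt0 k_gt0.
have -> : \prod_(i < N) qfac c (k * s) (k * a) i = dil k (\prod_(i < N) qfac c s a i).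
  rewrite rmorph_prod; apply: eq_bigr => i _.
  rewrite /qfac rmorphD rmorphM rmorphXn rmorph1 /= dil_psC dil_psX // -exprM.
  by congr (1 + psC c * psX ^+ _); ring.
by apply/eqX_dil/qprodE.
Qed.

Lemma dil_euler k j : (0 < k)%N -> (0 < j)%N -> dil k (euler j) = euler (k * j).
Proof. by move=> k_gt0 j_gt0; rewrite dil_qprod. Qed.

Lemma euler0 k : (0 < k)%N -> euler k 0%N = 1.
Proof. exact: qprod0. Qed.

(** Frobenius, factor by factor. *)
Lemma euler_pchar p k : p \in [pchar R] -> (0 < k)%N ->
  euler k ^+ p = euler (p * k).
Proof.
move=> pcharp k_gt0; have p_pr := pcharf_prime pcharp.
have pcharS : p \in [pchar (pser R)].
  by rewrite inE p_pr -(rmorph_nat psC) (pcharf0 pcharp) rmorph0 /=.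
apply: eqX_all => N.
apply: (@eqX_trans _ _ ((\prod_(i < N) qfac (-1) k k i) ^+ p)).
  by apply/eqX_exp/qprodE.
apply: eqX_sym; rewrite -prodrXl.
have -> : \prod_(i < N) qfac (-1) k k i ^+ p
        = \prod_(i < N) qfac (-1) (p * k) (p * k) i.
  apply: eq_bigr => i _; rewrite -(pFrobenius_autE pcharS) /qfac rmorphN rmorph1.
  rewrite !mulN1r pFrobenius_autB_comm; last exact: mulrC.
  rewrite !pFrobenius_autE expr1n -exprM; congr (1 - psX ^+ _); ring.
by apply: qprodE => //; rewrite muln_gt0 prime_gt0.
Qed.

End QProducts.

Lemma smap_qprod (R S : comNzRingType) (phi : {rmorphism R -> S}) c s a :
  smap phi (qprod c s a) = qprod (phi c) s a.
Proof.
apply/funext => n; rewrite /qprod /smap -/(smap phi _ n) rmorph_prod.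
congr (_ n); apply: eq_bigr => i _.
by rewrite /qfac rmorphD rmorphM rmorphXn rmorph1 /= smap_psC smap_psX.
Qed.

Lemma smap_euler (R S : comNzRingType) (phi : {rmorphism R -> S}) k :
  smap phi (euler R k) = euler S k.
Proof. by rewrite smap_qprod rmorphN1. Qed.

Lemma qpoch_euler k : qpoch k k = euler int k.
Proof.
apply/funext => n; rewrite /euler /qprod /qpoch -[LHS]/(ps_of_poly _ n) rmorph_prod.
congr (_ n); apply: eq_bigr => i _.
by rewrite rmorphB rmorph1 /= ps_of_polyXn /qfac rmorphN rmorph1 mulN1r.
Qed.

(** * The q-binomial theorem *)

Section QBinomial.
Variable S : comNzRingType.
Implicit Types q y z : S.

Fixpoint qbin q m k : S :=
  match m, k with
  | _, 0 => 1
  | 0, _.+1 => 0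
  | m'.+1, k'.+1 => qbin q m' k + q ^+ (m' - k') * qbin q m' k'
  end.

Definition qfact q m : S := \prod_(i < m) (1 - q ^+ i.+1).

Lemma qbin0 q m : qbin q m 0 = 1. Proof. by case: m. Qed.
Lemma qbin_small q m k : (m < k)%N -> qbin q m k = 0.
Proof.
elim: m k => [|m IHm] [|k] //= ltmk.
by rewrite !IHm ?mulr0 ?addr0 // ltnW.
Qed.

(** The variables y and z are kept homogeneous so that negative powers of q
    never appear when the product is centred. *)
Lemma qbinomial q y z m :
  \prod_(i < m) (y + z * q ^+ i) =
  \sum_(k < m.+1) q ^+ 'C(k, 2) * qbin q m k * z ^+ k * y ^+ (m - k).
Proof.
elim: m => [|m IHm]; first by rewrite big_ord0 big_ord1 /= !mul1r.
rewrite big_ord_recr /= IHm mulrDr [RHS]big_ord_recl.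
pose T k := q ^+ 'C(k, 2) * qbin q m k * z ^+ k * y ^+ (m.+1 - k).
have -> : (\sum_(k < m.+1) q ^+ 'C(k, 2) * qbin q m k * z ^+ k * y ^+ (m - k)) * y
        = T 0%N + \sum_(k < m.+1) T k.+1.
  have Tm : T m.+1 = 0 by rewrite /T qbin_small // mulr0 !mul0r.
  rewrite -(big_ord_recl m.+1 (fun k : 'I_m.+2 => T k)) [RHS]big_ord_recr /= Tm addr0.
  rewrite mulr_suml; apply: eq_bigr => k _.
  by rewrite /T subSn ?leq_ord // exprS; ring.
rewrite -addrA; congr (_ + _); first by rewrite /T qbin0.
rewrite mulr_suml -big_split; apply: eq_bigr => k _ /=.
rewrite /T /bump leq0n add1n subSS binS bin1.
have -> : q ^+ m = q ^+ k * q ^+ (m - k) by rewrite -exprD subnKC ?leq_ord.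
by rewrite exprD exprS; ring.
Qed.

Lemma qbin_fact q m k : (k <= m)%N ->
  qbin q m k * qfact q k * qfact q (m - k) = qfact q m.
Proof.
have qfactS i : qfact q i.+1 = qfact q i * (1 - q ^+ i.+1).
  exact: big_ord_recr.
elim: m k => [|m IHm] [|k] // lekm.
- by rewrite /qfact !big_ord0 /= !mul1r.
- by rewrite qbin0 subn0 {1}/qfact big_ord0 !mul1r.
rewrite /= subSS; have [->|ltkm] := eqVneq k m.
  have e := IHm m (leqnn m).
  rewrite qbin_small // subnn add0r expr0 mul1r qfactS -{2}e subnn; ring.
have {}ltkm : (k < m)%N by rewrite ltn_neqAle ltkm.
have e1 := IHm k.+1 ltkm; have e2 := IHm k (ltnW ltkm).
rewrite qfactS mulrDl mulrDl.
have em : qfact q (m - k) = qfact q (m - k.+1) * (1 - q ^+ (m - k)).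
  by rewrite -(subnSK ltkm) qfactS.
rewrite {1}em -qfactS.
have -> : qbin q m k.+1 * qfact q k.+1 * (qfact q (m - k.+1) * (1 - q ^+ (m - k)))
   = qfact q m * (1 - q ^+ (m - k)) by rewrite -e1; ring.
have -> : q ^+ (m - k) * qbin q m k * qfact q k.+1 * qfact q (m - k)
   = q ^+ (m - k) * (1 - q ^+ k.+1) * qfact q m by rewrite qfactS -e2; ring.
rewrite (qfactS m).
have -> : q ^+ m.+1 = q ^+ (m - k) * q ^+ k.+1 by rewrite -exprD; congr (_ ^+ _); lia.
by ring.
Qed.
Lemma qbinS q m k :
  qbin q m.+1 k.+1 = qbin q m k.+1 + q ^+ (m - k) * qbin q m k.
Proof. by []. Qed.
End QBinomial.
Arguments qbin : simpl never.

(** * Series indexed by a set of exponents *)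

(** The formal sum of w i q^(e i).  It is meaningful when the fibres of e are
    finite, which [finfib] expresses in cumulative form. *)
Definition gsum (R : comNzRingType) (I : choiceType) (e : I -> nat) (w : I -> R)
  : pser R := fun n => \sum_(i \in [set i | e i = n]%classic) w i.

Lemma gsumE (R : comNzRingType) (I : choiceType) (e : I -> nat) (w : I -> R) n
    (r : seq I) :
  uniq r -> (forall i, e i = n -> i \in r) ->
  gsum e w n = \sum_(i <- r | e i == n) w i.
Proof.
move=> r_uniq mem_r; rewrite bigfs //; last first.
  by move=> i /eqP/mem_r => ->.
by apply: eq_fsbigl; apply/seteqP; split=> i /= /eqP.
Qed.

Definition finfib (I : eqType) (e : I -> nat) :=
  forall n, exists r : seq I, forall i, (e i <= n)%N -> i \in r.

Lemma finfib_uniq (I : eqType) (e : I -> nat) n : finfib e ->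
  exists2 r : seq I, uniq r & forall i, (e i <= n)%N -> i \in r.
Proof.
case/(_ n) => r mem_r; exists (undup r) => [|i]; first exact: undup_uniq.
by rewrite mem_undup; apply: mem_r.
Qed.

Section GSum.
Variable R : comNzRingType.

Lemma gsumD (I : choiceType) (e : I -> nat) (v w : I -> R) : finfib e ->
  gsum e (fun i => v i + w i) = gsum e v + gsum e w.
Proof.
move=> fin_e; apply/funext => n; rewrite coefpsD.
have [r r_uniq mem_r] := finfib_uniq n fin_e.
have mem_n i : e i = n -> i \in r by move=> ein; rewrite mem_r ?ein.
by rewrite !(gsumE _ r_uniq mem_n) big_split.
Qed.

Lemma eq_gsum (I : choiceType) (e e' : I -> nat) (w w' : I -> R) :
  e =1 e' -> w =1 w' -> gsum e w = gsum e' w'.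
Proof. by move=> /funext-> /funext->. Qed.

Lemma gsum0 (I : choiceType) (e : I -> nat) (w : I -> R) n :
  (forall i, e i = n -> w i = 0) -> gsum e w n = 0.
Proof. by move=> w0; apply: fsbig1. Qed.

Lemma gsumM (I J : choiceType) (e : I -> nat) (e' : J -> nat) (w : I -> R)
    (w' : J -> R) : finfib e -> finfib e' ->
  gsum e w * gsum e' w' =
  gsum (fun p => e p.1 + e' p.2)%N (fun p => w p.1 * w' p.2).
Proof.
move=> fin_e fin_e'; apply/funext => n.
have [r r_uniq mem_r] := finfib_uniq n fin_e.
have [s s_uniq mem_s] := finfib_uniq n fin_e'.
rewrite (@gsumE _ _ _ _ n [seq (i, j) | i <- r, j <- s]); first last.
- move=> [i j] /= eij; apply/allpairsP; exists (i, j) => /=.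
  by split=> //; rewrite ?mem_r ?mem_s // -eij ?leq_addr ?leq_addl.
- by apply: allpairs_uniq => // -[i j] [i' j'].
rewrite big_mkcond big_allpairs /= coefpsM.
pose F i j k := (if e i == k then w i else 0) *
  (if e' j == (n - k)%N then w' j else 0).
transitivity (\sum_(k < n.+1) \sum_(i <- r) \sum_(j <- s) F i j k).
  apply: eq_bigr => k _; rewrite (@gsumE _ _ e w k r) //; last first.
    by move=> i ei; apply: mem_r; rewrite ei leq_ord.
  rewrite (@gsumE _ _ e' w' (n - k) s) //; last first.
    by move=> j ej; apply: mem_s; rewrite ej leq_subr.
  rewrite (big_mkcond (fun i => e i == k)) (big_mkcond (fun j => e' j == _)).
  exact: big_distrlr.
rewrite [LHS]exchange_big; apply: eq_bigr => i _ /=.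
rewrite [LHS]exchange_big; apply: eq_bigr => j _ /=.
rewrite /F; case: (leqP (e i) n) => [lein|ltni]; last first.
  rewrite big1 => [|k _]; first by case: eqP => // ein; lia.
  by case: eqP => [eik|_]; rewrite ?mul0r //; have := ltn_ord k; lia.
have lein' : (e i < n.+1)%N by [].
rewrite (bigD1 (Ordinal lein')) //= eqxx big1 ?addr0 => [|k neqk].
  have -> : (e' j == n - e i)%N = (e i + e' j == n)%N by lia.
  by case: eqP; rewrite ?mulr0.
case: eqP => [eik|_]; rewrite ?mul0r //.
by case/eqP: neqk; apply: val_inj.
Qed.
End GSum.

(** * Theta exponents and the limit of the q-binomial theorem *)

(** The exponent a j (j - 1) / 2 + s j, see [texpE]; for s <= a the truncated
    subtraction is exact. *)
Definition texp (a s : nat) (j : int) : nat :=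
  match j with
  | Posz n => a * 'C(n, 2) + s * n
  | Negz n => a * 'C(n.+2, 2) - s * n.+1
  end.

Lemma bin2Z n : 2 * ('C(n, 2))%:Z = n%:Z * (n%:Z - 1).
Proof.
elim: n => // n IHn; rewrite binS bin1 PoszD mulrDr IHn; lia.
Qed.

Lemma texpE a s j : (s <= a)%N ->
  2 * (texp a s j)%:Z = a%:Z * (j * (j - 1)) + 2 * s%:Z * j.
Proof.
move=> lesa; case: j => n /=.
  by rewrite PoszD !PoszM mulrDr !mulrA (mulrC 2) -!mulrA bin2Z; ring.
have := bin2Z n.+2; set b := 'C(n.+2, 2) => eb.
have leb : (n.+1 <= b)%N by nia.
have {}lesa : (s * n.+1 <= a * b)%N by apply: leq_mul.
rewrite NegzE -subzn // !PoszM mulrBr mulrCA eb; lia.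
Qed.

(** The linear growth that makes theta series well defined, uniformly in a and
    s. *)
Lemma texp_ge a s j : (0 < a)%N -> (s <= a)%N -> (`|j| <= (texp a s j).+1)%N.
Proof.
move=> a_gt0 lesa; case: j => n /=.
  have := bin2Z n; set b := 'C(n, 2) => eb.
  have : (n <= b.+1)%N by nia.
  by nia.
have := bin2Z n.+1; have := bin2Z n.+2.
set b := 'C(n.+2, 2); set c := 'C(n.+1, 2) => eb ec.
have ebc : b = (c + n.+1)%N by lia.
have : (n <= c)%N by nia.
by rewrite ebc; nia.
Qed.

Definition zrange n : seq int := [seq k%:Z - n%:Z | k <- iota 0 (n + n).+1].

Lemma zrange_uniq n : uniq (zrange n).
Proof. by rewrite map_inj_uniq ?iota_uniq // => i j; lia. Qed.

Lemma mem_zrange n j : (`|j| <= n)%N -> j \in zrange n.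
Proof.
move=> lejn; apply/mapP; exists (absz (j + n%:Z)); last lia.
by rewrite mem_iota; lia.
Qed.

Lemma finfib_texp a s : (0 < a)%N -> (s <= a)%N -> finfib (texp a s).
Proof.
move=> a_gt0 lesa n; exists (zrange n.+1) => j lejn; apply: mem_zrange.
exact: leq_trans (texp_ge j a_gt0 lesa) _.
Qed.

Section Theta.
Variable R : comNzRingType.
Variables a s : nat.
Hypotheses (a_gt0 : (0 < a)%N) (lesa : (s <= a)%N).

Lemma sum_zrange n (F : int -> pser R) :
  \sum_(k < (n + n).+1) F (k%:Z - n%:Z) = \sum_(j <- zrange n) F j.
Proof. by rewrite big_map -(big_mkord xpredT (fun k => F (k%:Z - n%:Z))). Qed.

Lemma theta_trunc (w : int -> R) n :
  eqX n (\sum_(k < (n + n).+1)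
           psC (w (k%:Z - n%:Z)) * psX ^+ texp a s (k%:Z - n%:Z))
        (gsum (texp a s) w).
Proof.
move=> m ltmn; rewrite (sum_zrange n (fun j => psC (w j) * psX ^+ texp a s j)).
rewrite (@gsumE _ _ _ _ m (zrange n)) ?zrange_uniq //; last first.
  by move=> j ejm; apply: mem_zrange; rewrite (leq_trans (texp_ge _ a_gt0 lesa)) ?ejm.
rewrite coefps_sum [RHS]big_mkcond; apply: eq_bigr => j _.
by rewrite coefpsCXn eq_sym.
Qed.

Lemma qfact_euler m : eqX m (euler R a) (qfact (psX ^+ a) m).
Proof.
apply: eqX_trans (qprodE _ _ a_gt0 (leqnn m)) _.
have -> // : \prod_(i < m) qfac (-1 : R) a a i = qfact (psX ^+ a) m.
apply: eq_bigr => i _; rewrite /qfac rmorphN rmorph1 mulN1r -exprM.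
by congr (1 - psX ^+ _); rewrite mulnS addnC.
Qed.

(** In the limit a central q-binomial coefficient is 1 / (q^a; q^a)_oo. *)
Lemma qbin_euler m k : (k <= m)%N ->
  eqX (minn k (m - k)) (euler R a * qbin (psX ^+ a) m k) 1.
Proof.
move=> lekm; set N := minn _ _.
have eN i : (N <= i)%N -> eqX N (euler R a) (qfact (psX ^+ a) i).
  by move=> leNi; apply: eqX_le leNi _; apply: qfact_euler.
apply: (@eqX_cancel _ _ (euler R a)); first exact: euler0.
apply: (@eqX_trans _ _ (qfact (psX ^+ a) m)).
  rewrite -(qbin_fact _ lekm) mulrCA.
  apply: (@eqX_trans _ _ (qfact (psX ^+ a) k * (qfact (psX ^+ a) (m - k)
                            * qbin (psX ^+ a) m k))).
    apply: eqXM; first by apply/eN/geq_minl.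
    by apply: eqXM => //; apply/eN/geq_minr.
  by rewrite mulrA mulrC mulrA.
rewrite mulr1; apply/eqX_sym/eN; rewrite /N; lia.
Qed.

(** Far from the centre the q-binomial coefficient is known to low precision
    only, but there the exponent is large; the two effects compensate up to the
    loss of one coefficient. *)
Lemma theta_limit (w : int -> R) n :
  eqX n.-1 (euler R a * \sum_(k < (n + n).+1) psC (w (k%:Z - n%:Z)) *
             psX ^+ texp a s (k%:Z - n%:Z) * qbin (psX ^+ a) (n + n) k)
        (gsum (texp a s) w).
Proof.
apply: (eqX_trans _ (eqX_le (leq_pred n) (@theta_trunc w n))).
rewrite mulr_sumr; apply: eqX_sum => k _.
have := texp_ge (k%:Z - n%:Z) a_gt0 lesa; set e := texp _ _ _ => le_e.
rewrite mulrCA -[X in eqX _ _ X]mulr1 -!mulrA; apply: eqXM => //.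
have lek := leq_ord k; apply: (eqX_le _ (eqX_XnM (qbin_euler lek))).
by rewrite /minn; case: ifP; lia.
Qed.
End Theta.

(** * The Jacobi triple product and the cube of the Euler product *)

Lemma expr_dist (R : comNzRingType) (c : R) n k : c * c = 1 ->
  c ^+ n * c ^+ k = c ^+ `|k%:Z - n%:Z|.
Proof.
move=> cc; have c2 m : c ^+ (m + m) = 1 by rewrite exprD -exprMn cc expr1n.
rewrite -exprD; case: (leqP n k) => [lenk|ltkn].
  by rewrite distnEl // -{1}(subnK lenk) addnCA exprD c2 mulr1.
by rewrite distnEr 1?ltnW // -{1}(subnK (ltnW ltkn)) -addnA exprD c2 mulr1.
Qed.

Lemma qbin_rmorph (S T : comNzRingType) (phi : {rmorphism S -> T}) q m k :
  phi (qbin q m k) = qbin (phi q) m k.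
Proof.
elim: m k => [|m IHm] [|k]; rewrite ?qbin0 ?rmorph1 ?rmorph0 //.
by rewrite !qbinS rmorphD rmorphM rmorphXn !IHm.
Qed.

Section TripleProduct.
Variables (R : comNzRingType) (a s : nat).
Hypotheses (a_gt0 : (0 < a)%N) (lesa : (s <= a)%N).

(** The power of q common to all terms when the q-binomial theorem is centred
    at k = n. *)
Definition texp_shift n := (s * n + a * 'C(n, 2) + a * n * n)%N.

Lemma texp_shiftE n k : (k <= n + n)%N ->
  (a * 'C(k, 2) + s * k + a * n * (n + n - k) =
     texp_shift n + texp a s (k%:Z - n%:Z))%N.
Proof.
move=> lek; have := texpE (k%:Z - n%:Z) lesa; have := bin2Z k; have := bin2Z n.
set b := 'C(k, 2); set d := 'C(n, 2); set t := texp _ _ _ => eb ed et.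
have e1 : 2 * (a%:Z * b%:Z + s%:Z * k%:Z + a%:Z * n%:Z * (n%:Z + n%:Z - k%:Z))
        = 2 * (s%:Z * n%:Z + a%:Z * d%:Z + a%:Z * n%:Z * n%:Z + t%:Z).
  transitivity (a%:Z * (2 * b%:Z) + 2 * s%:Z * k%:Z
                 + 2 * a%:Z * n%:Z * (n%:Z + n%:Z - k%:Z)); first by ring.
  transitivity (2 * s%:Z * n%:Z + a%:Z * (2 * d%:Z) + 2 * a%:Z * n%:Z * n%:Z
                 + 2 * t%:Z); last by ring.
  by rewrite ed eb et; ring.
apply/eqP; rewrite -eqz_nat /texp_shift !PoszD !PoszM -subzn // PoszD; apply/eqP.
lia.
Qed.

(** The factors below the centre, turned around: dividing the i-th one by
    c q^(s + a i) leaves 1 + c q^(a (n - i) - s), because c is its own inverse. *)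
Lemma low_factors (c : R) n (q := psX ^+ a : pser R) (z := psC c * psX ^+ s) :
  c * c = 1 ->
  \prod_(i < n) (q ^+ n + z * q ^+ i) =
    psC c ^+ n * psX ^+ (s * n + a * 'C(n, 2)) * \prod_(i < n) qfac c (a - s) a i.
Proof.
move=> cc.
rewrite [X in _ * X](reindex_inj rev_ord_inj) /=.
have -> : psC c ^+ n * psX ^+ (s * n + a * 'C(n, 2)) =
          \prod_(i < n) (psC c * psX ^+ (s + a * i)).
  rewrite big_split /= prodr_const card_ord prodrXr; congr (_ * psX ^+ _).
  rewrite big_split /= sum_nat_const card_ord mulnC -big_distrr /=.
  by rewrite -(big_mkord xpredT id) /= bin2_sum.
rewrite -big_split /=; apply: eq_bigr => i _.
rewrite /qfac /q /z -!exprM mulrDr mulr1 addrC; congr (_ + _).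
  by rewrite exprD mulrA.
rewrite mulrACA -rmorphM cc rmorph1 mul1r -exprD; congr (psX ^+ _).
have := ltn_ord i; nia.
Qed.

Lemma finite_triple (c : R) n : c * c = 1 ->
  \prod_(i < n) qfac c (a - s) a i * \prod_(i < n) qfac c s a i =
  \sum_(k < (n + n).+1) psC (c ^+ `|k%:Z - n%:Z|) *
      psX ^+ texp a s (k%:Z - n%:Z) * qbin (psX ^+ a) (n + n) k.
Proof.
move=> cc; pose z := psC c * psX ^+ s; pose q : pser R := psX ^+ a.
have := qbinomial q (q ^+ n) z (n + n).
rewrite big_split_ord /= low_factors //.
have -> : \prod_(i < n) (q ^+ n + z * q ^+ (n + i)) =
    psX ^+ (a * n * n) * \prod_(i < n) qfac c s a i.
  have -> : psX ^+ (a * n * n) = \prod_(i < n) psX ^+ (a * n) :> pser R.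
    by rewrite prodr_const card_ord exprM.
  rewrite -big_split /=.
  apply: eq_bigr => i _; rewrite /qfac /q /z -!exprM mulrDr mulr1.
  by rewrite mulrCA -mulrA -!exprD; congr (_ + _ * psX ^+ _); ring.
move=> e; apply: (@psXn_inj _ (texp_shift n)).
have psCn : psC c ^+ n * psC c ^+ n = 1 by rewrite -exprMn -rmorphM cc rmorph1 expr1n.
transitivity (psC c ^+ n * (psC c ^+ n * psX ^+ (s * n + a * 'C(n, 2)) *
    \prod_(i < n) qfac c (a - s) a i * (psX ^+ (a * n * n) * \prod_(i < n) qfac c s a i))).
  rewrite !mulrA psCn mul1r /texp_shift exprD; ring.
rewrite e !mulr_sumr; apply: eq_bigr => k _; rewrite -expr_dist // rmorphM !rmorphXn.
have := texp_shiftE (leq_ord k); rewrite /z exprMn /q -!exprM => ek.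
transitivity (psC c ^+ n * psC c ^+ k * qbin (psX ^+ a) (n + n) k *
   psX ^+ (a * 'C(k, 2) + s * k + a * n * (n + n - k))); first by rewrite !exprD; ring.
by rewrite ek exprD /=; ring.
Qed.

(** Taking c with c^2 = 1 rather than a general unit keeps all exponents of c
    nonnegative; the cases c = 1 and c = -1 are those of interest. *)
Theorem jacobi_triple (c : R) : c * c = 1 ->
  euler R a * (qprod c (a - s) a * qprod c s a) =
  gsum (texp a s) (fun j : int => c ^+ `|j|).
Proof.
move=> cc; apply: eqX_all => N.
have := @theta_limit R a s a_gt0 lesa (fun j : int => c ^+ `|j|) N.+1.
apply: eqX_trans => /=; apply: eqXM => //; rewrite -finite_triple //.
by apply: eqXM; apply: qprodE.
Qed.

End TripleProduct.

Section JacobiCube.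
Variable R : comNzRingType.
Local Notation q := (psX : pser R).

(** In the q-binomial theorem for the product of the q^N + z q^i, i < 2 N, the
    factor with i = N is q^N (1 + z).  So at z = -1 the derivative of the product
    is q^N times the product of the other factors, whereas the value is 0; the
    latter recentres the weights k of the derivative to k - N. *)
Lemma finite_cube n :
  \sum_(k < (n.+1 + n.+1).+1)
     psC ((-1) ^+ `|k%:Z - n.+1%:Z| * (k%:Z - n.+1%:Z)%:~R) *
       q ^+ texp 1 0 (k%:Z - n.+1%:Z) * qbin (q ^+ 1) (n.+1 + n.+1) k
  = - (qfact q n.+1 * qfact q n).
Proof.
set N := n.+1; rewrite expr1.
pose D k := q ^+ texp 1 0 (k%:Z - N%:Z) * qbin q (N + N) k.
pose sh := texp_shift 1 0 N.
pose L i := (q ^+ N)%:P + 'X * (q ^+ i)%:P.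
pose G := \prod_(i < N) L i * \prod_(i < n) L (N + i.+1)%N.
have eP : (q ^+ N)%:P * ((1 + 'X) * G) = \sum_(k < (N + N).+1) (q ^+ sh * D k)%:P * 'X^k.
  have := qbinomial q%:P (q ^+ N)%:P 'X (N + N); rewrite big_split_ord /=.
  rewrite [X in _ * X]big_ord_recl /= addn0.
  have -> : \prod_(i < N) ((q ^+ N)%:P + 'X * q%:P ^+ i) = \prod_(i < N) L i.
    by apply: eq_bigr => i _; rewrite -rmorphXn.
  have -> : \prod_(i < n) ((q ^+ N)%:P + 'X * q%:P ^+ (N + bump 0 i)) =
            \prod_(i < n) L (N + i.+1)%N.
    by apply: eq_bigr => i _; rewrite -rmorphXn.
  rewrite -rmorphXn /= => e.
  transitivity (\prod_(i < N) L i * (((q ^+ N)%:P + 'X * (q ^+ N)%:P) *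
    \prod_(i < n) L (N + i.+1)%N)); first by rewrite /G; ring.
  rewrite e; apply: eq_bigr => k _; rewrite -qbin_rmorph -!rmorphXn mulrAC.
  rewrite -!polyCM; congr (_%:P * _); rewrite /D.
  have := @texp_shiftE 1 0 isT isT _ _ (leq_ord k); rewrite -/sh !mul1n !mul0n addn0 => ek.
  rewrite mulrA -exprD -ek exprD exprM; ring.
have h0 : (1 + 'X : {poly pser R}).[-1] = 0 by rewrite !hornerE subrr.
have e0 : \sum_(k < (N + N).+1) (q ^+ sh * D k) * (-1) ^+ k = 0.
  have := congr1 (fun p => p.[-1]) eP; rewrite horner_sum.
  rewrite hornerM [X in _ * X]hornerM h0 mul0r mulr0 => /esym e.
  rewrite -[RHS]e; apply: eq_bigr => k _.
  by rewrite hornerM hornerC hornerXn.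
have e1 : q ^+ N * G.[-1] = \sum_(k < (N + N).+1) (q ^+ sh * D k) * ((-1) ^+ k.-1 *+ k).
  have := congr1 (fun p => p^`().[-1]) eP; rewrite raddf_sum horner_sum.
  rewrite derivM derivC mul0r add0r derivM derivD derivX -polyC1 derivC add0r.
  rewrite polyC1 mul1r hornerM hornerC hornerD [X in _ + X]hornerM h0 mul0r addr0.
  move=> ->; apply: eq_bigr => k _.
  by rewrite /= derivM derivC mul0r add0r derivXn hornerM hornerC hornerMn hornerXn.
have hL i : (L i).[-1] = q ^+ N - q ^+ i by rewrite !hornerE mulN1r.
have eA : (\prod_(i < N) L i).[-1] = (-1) ^+ N * q ^+ 'C(N, 2) * qfact q N.
  have N1N1 : -1 * -1 = 1 :> R by rewrite mulrNN mulr1.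
  have := @low_factors R 1 0 isT isT (-1) N N1N1.
  rewrite mul0n add0n mul1n !expr1 rmorphN1 expr0 mulr1.
  rewrite horner_prod => e; transitivity (\prod_(i < N) (q ^+ N + -1 * q ^+ i)).
    by apply: eq_bigr => i _; rewrite hL mulN1r.
  rewrite e; congr (_ * _); apply: eq_bigr => i _.
  by rewrite /qfac rmorphN1 mulN1r mul1n addn1.
have eB : (\prod_(i < n) L (N + i.+1)%N).[-1] = q ^+ (N * n) * qfact q n.
  rewrite horner_prod exprM -[in X in _ ^+ X](card_ord n) -prodr_const -big_split /=.
  by apply: eq_bigr => i _; rewrite hL exprD mulrBr mulr1.
have sg : (-1) ^+ N * (-1) ^+ N = 1 :> pser R by rewrite -exprMn mulrNN mulr1 expr1n.
have eG : q ^+ N * G.[-1] = (-1) ^+ N * (q ^+ sh * (qfact q N * qfact q n)).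
  rewrite /G hornerM eA eB /sh /texp_shift mul0n add0n !mul1n.
  have -> : ('C(N, 2) + N * N = N + 'C(N, 2) + N * n)%N by rewrite /N; lia.
  by rewrite !exprD; ring.
apply: (@psXn_inj _ sh); rewrite mulrN.
transitivity ((-1) ^+ N * (- (q ^+ N * G.[-1]))); last first.
  by rewrite eG mulrN mulrA sg mul1r.
rewrite e1; transitivity (\sum_(k < (N + N).+1) (-1) ^+ N *
   (- (q ^+ sh * D k * ((-1) ^+ k.-1 *+ k)) - N%:R * (q ^+ sh * D k * (-1) ^+ k)));
  last by rewrite -mulr_sumr sumrB sumrN -mulr_sumr e0 mulr0 subr0.
rewrite mulr_sumr; apply: eq_bigr => k _.
rewrite -mulrA -/(D k) -expr_dist ?mulrNN ?mulr1 // !rmorphM !rmorphXn rmorphN1.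
rewrite rmorph_int intrB -!pmulrn -mulr_natr.
case: (nat_of_ord k) => [|k']; rewrite /= ?mulr0n ?exprS; ring.
Qed.

Theorem jacobi_cube :
  euler R 1 ^+ 3 = - gsum (texp 1 0) (fun j : int => (-1) ^+ `|j| * j%:~R).
Proof.
apply: eqX_all => N.
have := @theta_limit R 1 0 isT isT (fun j : int => (-1) ^+ `|j| * j%:~R) N.+1.
rewrite finite_cube /= mulrN => /(eqXM (@eqX_refl _ N (-1))).
rewrite !mulN1r opprK; apply: eqX_trans; rewrite exprS expr2.
apply: eqXM => //; apply: eqXM.
  by apply: eqX_le _ (@qfact_euler R 1 isT N.+1) => //.
exact: (@qfact_euler R 1 isT N).
Qed.
End JacobiCube.

(** * Reindexing *)

Section Reindexing.
Variables (R : comNzRingType) (I J : choiceType).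
Variables (h : J -> I) (g : I -> J).
Hypothesis hK : cancel h g.
Variables (e : I -> nat) (e' : J -> nat) (w : I -> R).

(** The common form of all the changes of variables below: g need only invert h
    on the support of w inside the fibre. *)
Lemma gsum_coef n n' :
  (forall j, (e (h j) == n) = (e' j == n')) ->
  (forall i, e i = n -> w i != 0 -> h (g i) = i) ->
  gsum e w n = gsum e' (w \o h) n'.
Proof.
move=> eh w_im; pose B := [set j | e' j = n']%classic.
rewrite /gsum -/B -(@fsbig_image _ _ _ _ _ B h w); last first.
  by move=> i j _ _; apply: (can_inj hK).
apply/esym/fsbig_widen => [_ [j /= /eqP Bj <-]|i /= [/= ei Ni]].
  by apply/eqP; rewrite eh.
apply/eqP/negPn/negP => w0; apply: Ni; exists (g i); last exact: w_im.
by apply/eqP; rewrite -eh w_im ?ei.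
Qed.

Lemma gsum_sec m r : (0 < m)%N -> (r < m)%N ->
  (forall j, e (h j) = m * e' j + r)%N ->
  (forall i, (e i %% m)%N = r -> h (g i) = i) ->
  sec m r (gsum e w) = gsum e' (w \o h).
Proof.
move=> m_gt0 ltrm eh im; apply/funext => n; apply: gsum_coef.
  by move=> j; rewrite eh eqn_add2r eqn_pmul2l.
by move=> i ei _; apply: im; rewrite ei mulnC modnMDl modn_small.
Qed.

Lemma gsum_pull k r : (0 < k)%N ->
  (forall j, e (h j) = k * e' j + r)%N ->
  (forall i, w i != 0 -> h (g i) = i) ->
  gsum e w = psX ^+ r * dil k (gsum e' (w \o h)).
Proof.
move=> k_gt0 eh im; apply/funext => n; rewrite coefpsXnM coef_dil //.
have gs0 : (forall q, n = (k * q + r)%N -> False) -> gsum e w n = 0.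
  move=> nn; apply: gsum0 => i ein; apply/eqP/negPn/negP => wi0.
  by apply: (nn (e' (g i))); rewrite -eh im.
case: leqP => [lern|ltnr]; last by apply: gs0 => q; lia.
case: ifPn => [/dvdnP[q en]|ndvd]; last first.
  by apply: gs0 => q en; case/negP: ndvd; rewrite en addnK dvdn_mulr.
have {en} -> : n = (k * q + r)%N by rewrite mulnC -en subnK.
rewrite addnK mulKn //; apply: gsum_coef; last by move=> i _; apply: im.
by move=> j; rewrite eh eqn_add2r eqn_pmul2l.
Qed.

Lemma finfib_pull k r : (0 < k)%N ->
  (forall j, e (h j) = k * e' j + r)%N -> finfib e -> finfib e'.
Proof.
move=> k_gt0 eh fin_e n; have [s mem_s] := fin_e (k * n + r)%N.
exists (map g s) => j lejn; rewrite -(hK j); apply: map_f; apply: mem_s.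
by rewrite eh leq_add2r leq_pmul2l.
Qed.
End Reindexing.

Lemma dil_gsum (R : comNzRingType) (I : choiceType) (e : I -> nat) (w : I -> R) k :
  (0 < k)%N -> dil k (gsum e w) = gsum (fun i => k * e i)%N w.
Proof.
move=> k_gt0; apply/esym; rewrite -[RHS]mul1r -(expr0 psX).
by apply: (@gsum_pull _ _ _ id id) => // j; rewrite addn0.
Qed.

Lemma finfib_pair (I J : choiceType) (e : I -> nat) (e' : J -> nat) :
  finfib e -> finfib e' -> finfib (fun p : I * J => e p.1 + e' p.2)%N.
Proof.
move=> fin_e fin_e' n; have [r mem_r] := fin_e n; have [s mem_s] := fin_e' n.
exists [seq (i, j) | i <- r, j <- s] => -[i j] /= leij.
by apply: allpairs_f; [apply: mem_r|apply: mem_s]; lia.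
Qed.

Lemma finfib_scale (I : eqType) (e : I -> nat) k : (0 < k)%N ->
  finfib e -> finfib (fun i => k * e i)%N.
Proof.
move=> k_gt0 fin_e n; have [r mem_r] := fin_e n; exists r => i lei.
by apply: mem_r; apply: leq_trans lei; apply: leq_pmull.
Qed.

(** * Classical theta series *)

Section ThetaProducts.
Variable R : comNzRingType.
Let N1N1 : -1 * -1 = 1 :> R. Proof. by rewrite mulrNN mulr1. Qed.

Lemma pentagonal : euler R 1 = gsum (texp 3 2) (fun j : int => (-1) ^+ `|j|).
Proof.
have e : euler R 1 = qprod (-1) 1 3 * qprod (-1) 2 3 * euler R 3.
  by rewrite {1}/euler (@qprod_split _ 3) // !big_ord_recr big_ord0 /= mul1r.
by rewrite -jacobi_triple // e; ring.
Qed.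

(** Gauss: phi(-q) = f_1^2 / f_2; here [texp 2 1 j] is j^2. *)
Lemma gauss_square :
  gsum (texp 2 1) (fun j : int => (-1) ^+ `|j|) * euler R 2 = euler R 1 ^+ 2.
Proof.
have e : euler R 1 = qprod (-1) 1 2 * euler R 2.
  by rewrite {1}/euler (@qprod_split _ 2) // !big_ord_recr big_ord0 /= mul1r.
by rewrite -jacobi_triple // e; ring.
Qed.

Lemma qprodM_opp c s a : (0 < a)%N ->
  qprod c s a * qprod (- c) s a = qprod (- (c * c)) (2 * s) (2 * a) :> pser R.
Proof.
move=> a_gt0; apply: eqX_all => N.
apply: (@eqX_trans _ _ (\prod_(i < N) qfac c s a i * \prod_(i < N) qfac (- c) s a i)).
  by apply: eqXM; apply: qprodE.
rewrite -big_split /=; apply: eqX_sym.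
have -> : \prod_(i < N) (qfac c s a i * qfac (- c) s a i)
  = \prod_(i < N) qfac (- (c * c)) (2 * s) (2 * a) i.
  apply: eq_bigr => i _; rewrite /qfac !rmorphN rmorphM.
  have -> : (2 * a * i + 2 * s = (a * i + s) + (a * i + s))%N by ring.
  by set m := (a * i + s)%N; rewrite exprD; ring.
by apply: qprodE => //; rewrite muln_gt0.
Qed.

Lemma qprod_shift c a : (0 < a)%N ->
  qprod c 0 a = (1 + psC c) * qprod c a a :> pser R.
Proof.
move=> a_gt0; apply: eqX_all => N.
apply: (eqX_trans (@qprodE _ N N.+1 _ _ _ a_gt0 (leqnSn N))).
rewrite big_ord_recl; apply: eqXM; first by rewrite /qfac muln0 mulr1.
apply: eqX_sym; rewrite (eq_bigr (fun i : 'I_N => qfac c a a i)); first exact: qprodE.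
by move=> i _; rewrite /qfac /=; congr (1 + psC c * psX ^+ _); rewrite /bump; lia.
Qed.

(** Gauss: f_2^2 / f_1 is the theta series of the triangular numbers, each of
    which is counted twice by the sum over the integers. *)
Lemma gauss_triangular :
  euler R 1 * gsum (texp 1 0) (fun=> 1) = 2%:R * euler R 2 ^+ 2.
Proof.
have -> : gsum (texp 1 0) (fun=> 1) = gsum (texp 1 0) (fun j : int => 1 ^+ `|j|) :> pser R.
  by apply: eq_gsum => // j; rewrite expr1n.
rewrite -jacobi_triple ?mulr1 //= qprod_shift // rmorph1.
have := @qprodM_opp 1 1 1 isT; rewrite !mul1r => e.
have {}e : euler R 2 = qprod 1 1 1 * euler R 1 by exact: esym e.
by rewrite e; ring.
Qed.

(** The terms j and 1 - j cancel; in product form, the factor 1 - q^0 is 0. *)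
Lemma alternating_triangular :
  gsum (texp 1 0) (fun j : int => (-1) ^+ `|j|) = 0 :> pser R.
Proof.
by rewrite -jacobi_triple //= qprod_shift // rmorphN1 subrr mul0r !mulr0.
Qed.

(** Averaging the terms j and 1 - j of the cube formula makes the weight
    proportional to 1 - 2 j, a square root of 1 + 8 [texp 1 0 j]. *)
Lemma jacobi_cube2 : 2%:R * euler R 1 ^+ 3 =
  gsum (texp 1 0) (fun j : int => (-1) ^+ `|j| * (1 - 2 * j)%:~R).
Proof.
rewrite jacobi_cube.
have fin := @finfib_texp 1 0 isT isT.
pose w j : R := (-1) ^+ `|j| * j%:~R.
have -> : gsum (texp 1 0) (fun j : int => (-1) ^+ `|j| * (1 - 2 * j)%:~R)
  = gsum (texp 1 0) (fun j : int => (-1) ^+ `|j| + (- w j - w j)) :> pser R.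
  by apply: eq_gsum => // j; rewrite /w intrB intrM; ring.
have eN : gsum (texp 1 0) (fun j => - w j) = - gsum (texp 1 0) w.
  apply/eqP; rewrite -addr_eq0 -gsumD //; apply/eqP/funext => n.
  by apply: gsum0 => j _; rewrite addNr.
by rewrite !gsumD // alternating_triangular add0r eN -/w; ring.
Qed.

End ThetaProducts.

(** * The eighth power of the Euler product *)

Section Dissection.
Variable R : comNzRingType.
Implicit Types f b : pser R.

Lemma secX_dil b : sec 2 1 (psX * dil 2 b) = b.
Proof. by apply/funext => n; rewrite /sec addn1 coefpsXM coef_dil_mul. Qed.

Lemma sec0X_dil b : sec 2 0 (psX * dil 2 b) = 0.
Proof.
apply/funext => n; rewrite /sec addn0 coefpsXM; case: n => [|n]; first by [].
by rewrite mulnS addSn coef_dil // add1n dvdn2 /= mul2n odd_double.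
Qed.

Lemma dissect2 f : f = dil 2 (sec 2 0 f) + psX * dil 2 (sec 2 1 f).
Proof.
apply: (@sec_inj _ 2) => // -[|[|//]] _; rewrite secD sec_dil //.
  by rewrite sec0X_dil addr0.
by rewrite secX_dil add0r.
Qed.

Lemma sec_sqr f : sec 2 1 (f ^+ 2) = 2%:R * (sec 2 0 f * sec 2 1 f).
Proof.
set a := sec 2 0 f; set b := sec 2 1 f.
have -> : f ^+ 2 = dil 2 (a ^+ 2) + psX ^+ 2 * dil 2 (b ^+ 2) + psX * dil 2 (2%:R * (a * b)).
  by rewrite {1}[f]dissect2 -/a -/b !rmorphXn !rmorphM rmorph_nat /=; ring.
rewrite !secD secX_dil -(@dil_psX R 2) // -rmorphM /= !sec_dil //=.
by rewrite !add0r.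
Qed.
End Dissection.

Lemma texp10 j : 2 * (texp 1 0 j)%:Z = j * (j - 1).
Proof. by rewrite texpE //; ring. Qed.
Lemma texp21 j : (texp 2 1 j)%:Z = j * j.
Proof. by apply: (mulfI (_ : 2 != 0)) => //; rewrite texpE //; ring. Qed.
Lemma texp32 j : 2 * (texp 3 2 j)%:Z = 3 * (j * j) + j.
Proof. by rewrite texpE //; ring. Qed.
Lemma texp43 j : (texp 4 3 j)%:Z = 2 * (j * j) + j.
Proof. by apply: (mulfI (_ : 2 != 0)) => //; rewrite texpE //; ring. Qed.

Definition evenz (x : int) : bool := (2 %| x)%Z.
Lemma evenzP x : reflect (exists m, x = 2 * m) (evenz x).
Proof. by apply: (iffP dvdzP) => -[m ->]; exists m; rewrite mulrC. Qed.

Lemma oddz_ex x : ~~ evenz x -> exists m, x = 2 * m + 1.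
Proof. by rewrite /evenz => odd_x; exists (x %/ 2)%Z; lia. Qed.

Lemma signz_mul (R : comNzRingType) x y :
  (-1) ^+ `|x| * (-1) ^+ `|y| = (-1) ^+ (~~ evenz (x + y)) :> R.
Proof.
rewrite -exprD -signr_odd; congr (_ ^+ nat_of_bool _); rewrite /evenz; lia.
Qed.

Section EvenOddPairs.
Variables (R : comNzRingType) (e : int * int -> nat) (w : int * int -> R).
Hypothesis fin_e : finfib e.

Lemma gsum_parity :
  gsum e w = gsum e (fun p => (evenz (p.1 + p.2))%:R * w p)
           + gsum e (fun p => (~~ evenz (p.1 + p.2))%:R * w p).
Proof.
rewrite -gsumD //; apply: eq_gsum => // p.
by case: evenz; rewrite /= mul1r mul0r ?addr0 ?add0r.
Qed.
End EvenOddPairs.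

(** In x^2 + y^2 the pairs with x + y even are (u + v, u - v), of norm
    2 (u^2 + v^2), and the others are (u + v - 1, u - v), of norm 1 plus twice
    u (u - 1) + v (v - 1). *)
Lemma theta_square (R : comNzRingType)
    (phi := gsum (texp 2 1) (fun=> 1) : pser R) (psi := gsum (texp 1 0) (fun=> 1)) :
  gsum (texp 2 1) (fun j : int => (-1) ^+ `|j|) ^+ 2 =
  dil 2 (phi ^+ 2) - psX * dil 2 (dil 2 psi ^+ 2).
Proof.
have fin1 := @finfib_texp 2 1 isT isT; have fin0 := @finfib_texp 1 0 isT isT.
have fin2 := finfib_scale (isT : 0 < 2)%N fin0.
rewrite expr2 gsumM // gsum_parity; last exact: finfib_pair.
congr (_ + _).
  rewrite (@gsum_pull _ _ _ (fun p => (p.1 + p.2, p.1 - p.2))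
    (fun p => ((p.1 + p.2) %/ 2, (p.1 - p.2) %/ 2)%Z) _ _
    (fun p => texp 2 1 p.1 + texp 2 1 p.2)%N _ 2 0) // ?expr0 ?mul1r.
  - rewrite /phi expr2 gsumM //; congr (dil 2 _); apply: eq_gsum => // p /=.
    by rewrite signz_mul; case: (boolP (evenz _)) => // /evenzP []; exists p.1; ring.
  - by case=> u v /=; congr (_, _); lia.
  - case=> u v /=; have := texp21 (u + v); have := texp21 (u - v).
    by have := texp21 u; have := texp21 v; lia.
  case=> x y /=; case: (boolP (evenz _)) => [|_]; last by rewrite mul0r eqxx.
  by rewrite /evenz => ev _; congr (_, _); lia.
rewrite -mulrN -rmorphN /=.
rewrite (@gsum_pull _ _ _ (fun p => (p.1 + p.2 - 1, p.1 - p.2))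
    (fun p => ((p.1 + p.2 + 1) %/ 2, (p.1 - p.2 + 1) %/ 2)%Z) _ _
    (fun p => 2 * texp 1 0 p.1 + 2 * texp 1 0 p.2)%N _ 2 1) // ?expr1.
- congr (_ * dil 2 _); rewrite dil_gsum // expr2 gsumM //.
  apply/eqP; rewrite -addr_eq0 -gsumD; last exact: (finfib_pair fin2 fin2).
  apply/eqP/funext => n; apply: gsum0 => p _ /=.
  rewrite signz_mul; case: (boolP (evenz _)) => [|_]; first by rewrite /evenz; lia.
  by rewrite /= !mul1r addNr.
- by case=> u v /=; congr (_, _); lia.
- case=> u v /=; have := texp21 (u + v - 1); have := texp21 (u - v).
  by have := texp10 u; have := texp10 v; lia.
case=> x y /=; case: (boolP (evenz _)) => [_|]; first by rewrite mul0r eqxx.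
by rewrite /evenz => ev _; congr (_, _); lia.
Qed.

(** For triangular exponents x (x - 1) / 2 + y (y - 1) / 2, the symmetry
    y -> 1 - y changes the parity of x + y; so both parities contribute the sum
    over (x, y) = (u + v, u - v), of exponent u (u - 1) + v^2. *)
Lemma psi_square (R : comNzRingType)
    (phi := gsum (texp 2 1) (fun=> 1) : pser R) (psi := gsum (texp 1 0) (fun=> 1)) :
  psi ^+ 2 = 2%:R * (dil 2 psi * phi).
Proof.
have fin1 := @finfib_texp 2 1 isT isT; have fin0 := @finfib_texp 1 0 isT isT.
have fin2 := finfib_scale (isT : 0 < 2)%N fin0.
have epsi : dil 2 psi * phi =
  gsum (fun p => 2 * texp 1 0 p.1 + texp 2 1 p.2)%N (fun=> 1).
  by rewrite dil_gsum // gsumM //; apply: eq_gsum => // p; rewrite mulr1.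
rewrite expr2 gsumM // gsum_parity; last exact: finfib_pair.
rewrite mulr2n mulrDl mul1r; congr (_ + _); rewrite epsi.
  rewrite (@gsum_pull _ _ _ (fun p => (p.1 + p.2, p.1 - p.2))
    (fun p => ((p.1 + p.2) %/ 2, (p.1 - p.2) %/ 2)%Z) _ _
    (fun p => 2 * texp 1 0 p.1 + texp 2 1 p.2)%N _ 1 0) // ?expr0 ?mul1r.
  - rewrite dil_gsum //; apply: eq_gsum => p /=; first by rewrite mul1n.
    by case: (boolP (evenz _)) => [_|]; rewrite ?mulr1 // /evenz; lia.
  - by case=> u v /=; congr (_, _); lia.
  - case=> u v /=; have := texp10 (u + v); have := texp10 (u - v).
    by have := texp10 u; have := texp21 v; lia.
  case=> x y /=; case: (boolP (evenz _)) => [|_]; last by rewrite mul0r eqxx.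
  by rewrite /evenz => ev _; congr (_, _); lia.
rewrite (@gsum_pull _ _ _ (fun p => (p.1 + p.2, 1 - p.1 + p.2))
    (fun p => ((p.1 - p.2 + 1) %/ 2, (p.1 + p.2 - 1) %/ 2)%Z) _ _
    (fun p => 2 * texp 1 0 p.1 + texp 2 1 p.2)%N _ 1 0) // ?expr0 ?mul1r.
- rewrite dil_gsum //; apply: eq_gsum => p /=; first by rewrite mul1n.
  by case: (boolP (evenz _)) => [|_]; rewrite ?mulr1 // /evenz; lia.
- by case=> u v /=; congr (_, _); lia.
- case=> u v /=; have := texp10 (u + v); have := texp10 (1 - u + v).
  by have := texp10 u; have := texp21 v; lia.
case=> x y /=; case: (boolP (evenz _)) => [_|]; first by rewrite mul0r eqxx.
by rewrite /evenz => ev _; congr (_, _); lia.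
Qed.

(** With phi(-q)^2 = A(q^2) - q B(q^2), the odd part of f_1^8 = f_2^4 phi(-q)^4 is
    - 2 q f_2^4 A(q^2) B(q^2); as 4 A B = psi^4 and f_1 psi = 2 f_2^2, this is
    - 8 q f_4^8. *)
Lemma sec_euler8 (R : comNzRingType) :
  4%:R * sec 2 1 (euler R 1 ^+ 8) = - (32%:R * euler R 2 ^+ 8).
Proof.
pose phi := gsum (texp 2 1) (fun=> 1) : pser R.
pose psi := gsum (texp 1 0) (fun=> 1) : pser R.
set phim := gsum (texp 2 1) (fun j : int => (-1) ^+ `|j|) : pser R.
have e1 : euler R 1 ^+ 8 = dil 2 (euler R 1 ^+ 4) * (phim ^+ 2) ^+ 2.
  by rewrite rmorphXn /= dil_euler // -[8%N]/(2 * 4)%N exprM -gauss_square -/phim; ring.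
rewrite e1 sec_dilM // sec_sqr theta_square -/phi -/psi secD sec_dil //=.
rewrite secD sec_dil //= -mulrN -rmorphN /= secX_dil sec0X_dil add0r addr0.
(* Up to f_1^4, this is - 2 times 4 A B = (2 psi(q^2) phi)^2 = psi^4. *)
transitivity (- (2%:R * euler R 1 ^+ 4 * (2%:R * (dil 2 psi * phi)) ^+ 2)).
  by ring.
rewrite -psi_square -/psi.
transitivity (- (2%:R * (euler R 1 * psi) ^+ 4)); first by ring.
by rewrite gauss_triangular; ring.
Qed.

(** * Supports modulo 5 *)

Lemma modz5_cases (j : int) : exists m c,
  j = 5 * m + c /\ (c = 0 \/ c = 1 \/ c = 2 \/ c = 3 \/ c = 4).
Proof. by exists (j %/ 5)%Z, (j %% 5)%Z; lia. Qed.

Lemma sec5_pentagonal (R : comNzRingType) r : (r == 3%N) || (r == 4%N) ->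
  sec 5 r (euler R 1) = 0.
Proof.
move=> r34; rewrite pentagonal; apply/funext => n; apply: gsum0 => j ej.
have := texp32 j; rewrite ej.
have [m [c [->]]] := modz5_cases j.
by case/orP: r34 => /eqP ->; case=> [->|[->|[->|[->|->]]]]; lia.
Qed.

Lemma sec5_cube_int r : (r == 2%N) || (r == 4%N) -> sec 5 r (euler int 1 ^+ 3) = 0.
Proof.
move=> r24; apply/funext => n.
suff : (2%:R * euler int 1 ^+ 3) (5 * n + r)%N = 0.
  by rewrite mulr_natl coefpsMn /sec => /eqP; rewrite Num.Theory.mulrn_eq0 => /eqP.
rewrite jacobi_cube2; apply: gsum0 => j ej; have := texp10 j; rewrite ej.
have [m [c [->]]] := modz5_cases j.
by case/orP: r24 => /eqP ->; case=> [->|[->|[->|[->|->]]]]; lia.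
Qed.

(** Triangular numbers avoid the classes of 2 and 4 modulo 5, and if
    j (j - 1) / 2 is 3 modulo 5, then so is j, and 5 divides 1 - 2 j. *)
Lemma sec5_cube_F5 r : (1 < r < 5)%N ->
  sec 5 r (euler 'F_5 1 ^+ 3) = 0.
Proof.
move=> r_bnd; apply/funext => n.
suff : (2%:R * euler 'F_5 1 ^+ 3) (5 * n + r)%N = 0.
  rewrite mulr_natl coefpsMn -mulr_natl => /eqP.
  by rewrite mulf_eq0 => /orP[//|/eqP].
rewrite jacobi_cube2; apply: gsum0 => j ej; have := texp10 j; rewrite ej.
have [m [c [ej5 c5]]] := modz5_cases j.
have r5 : r = 2%N \/ r = 3%N \/ r = 4%N by lia.
rewrite ej5 => e2.
have -> : 1 - 2 * (5 * m + c) = 5 * (- 1 - 2 * m).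
  by case: r5 e2 => [->|[->|->]]; case: c5 => [->|[->|[->|[->|->]]]]; lia.
by rewrite intrM (_ : 5%:~R = 0 :> 'F_5) ?mul0r ?mulr0 //; apply/eqP.
Qed.

(** * Theta series in characteristic 2 *)

Section CharTwo.
Variable R : comNzRingType.
Hypothesis char2 : 2 \in [pchar R].

Lemma addrr2 (x : R) : x + x = 0.
Proof. by rewrite -mulr2n -mulr_natr (pcharf0 char2) mulr0. Qed.

Lemma oppr2 (x : R) : - x = x.
Proof. by apply/eqP; rewrite eq_sym -addr_eq0 addrr2. Qed.

Lemma sign2 n : (-1) ^+ n = 1 :> R.
Proof. by rewrite oppr2 expr1n. Qed.

(** In characteristic 2 the two points of an orbit cancel; P tells these
    two points apart. *)
Lemma gsum_involution (I : choiceType) (e : I -> nat) (sigma : I -> I)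
    (P : pred I) :
  finfib e -> involutive sigma -> (forall i, e (sigma i) = e i) ->
  (forall i, sigma i != i -> P (sigma i) = ~~ P i) ->
  gsum e (fun=> 1) = gsum e (fun i => (sigma i == i)%:R) :> pser R.
Proof.
move=> fin_e sigmaK e_sigma P_sigma.
pose u i : R := ((sigma i != i) && P i)%:R.
pose v i : R := ((sigma i != i) && ~~ P i)%:R.
have uv : gsum e u = gsum e v.
  have -> : gsum e u = psX ^+ 0 * dil 1 (gsum e (u \o sigma)).
    by apply: (@gsum_pull _ _ _ sigma sigma) => // j; rewrite mul1n addn0.
  rewrite mul1r dil_gsum //; apply: eq_gsum => i; rewrite ?mul1n // /u /v /=.
  rewrite sigmaK eq_sym; case: (eqVneq (sigma i) i) => //= ne.
  by rewrite P_sigma.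
transitivity (gsum e (fun i => (sigma i == i)%:R + (u i + v i))).
  apply: eq_gsum => // i; rewrite /u /v; case: eqVneq => _ /=; first by rewrite !addr0.
  by case: (P i); rewrite ?add0r ?addr0.
rewrite !gsumD // uv; apply/funext => n.
by rewrite !coefpsD addrr2 addr0.
Qed.

Lemma pentagonal2 : euler R 1 = gsum (texp 3 2) (fun=> 1).
Proof. by rewrite pentagonal; apply: eq_gsum => // j; apply: sign2. Qed.

(** In the cube formula only the odd j survive, and they represent each
    triangular number once. *)
Lemma cube2 : euler R 1 ^+ 3 = gsum (texp 4 3) (fun=> 1).
Proof.
rewrite jacobi_cube; have two0 : 2%:~R = 0 :> R by exact: (pcharf0 char2).
have -> : - gsum (texp 1 0) (fun j : int => (-1) ^+ `|j| * j%:~R)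
        = gsum (texp 1 0) (fun j : int => (~~ evenz j)%:R) :> pser R.
  apply/funext => n; rewrite coefpsN oppr2; congr (_ n); apply: eq_gsum => // j.
  rewrite sign2 mul1r; case: (boolP (evenz j)) => [/evenzP[m ->]|odd_j].
    by rewrite intrM two0 mul0r.
  have -> : j = 2 * (j %/ 2)%Z + 1 by move: odd_j; rewrite /evenz; lia.
  by rewrite intrD intrM two0 mul0r add0r.
rewrite (@gsum_pull _ _ _ (fun i => 2 * i + 1) (fun j => ((j - 1) %/ 2)%Z) _ _
   (texp 4 3) _ 1 0) // ?expr0 ?mul1r.
- rewrite dil_gsum //; apply: eq_gsum => i /=; first by rewrite mul1n.
  by rewrite (_ : evenz _ = false) //; rewrite /evenz; lia.
- by move=> i; lia.
- by move=> i; have := texp10 (2 * i + 1); have := texp43 i; lia.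
move=> j; case: (boolP (evenz j)) => [_|]; first by rewrite eqxx.
by rewrite /evenz; lia.
Qed.

(** Multiplied by 24, and with 8 added, the exponents of f_1^3 f_5 are the
    values 5 x^2 + 3 y^2, where x = 6 l + 1 and y = 4 i + 1 or its opposite,
    chosen congruent to x modulo 4.  The map (x, y) -> ((x + 3 y) / 4,
    (5 x - y) / 4) is an involutive isometry.  With y = x - 4 t it is
    (x, t) -> (x - 3 t, - t), and t has the parity of the exponent; for t = 2 r
    it preserves the shape x = 6 l + 1 and reads (l, r) -> (l - r, - r). *)
Lemma sec0_cube_pentagonal :
  sec 2 0 (euler R 1 ^+ 3 * euler R 5) = euler R 4.
Proof.
have fin3 := @finfib_texp 3 2 isT isT; have fin4 := @finfib_texp 4 3 isT isT.
have fin5 := finfib_scale (isT : 0 < 5)%N fin3.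
rewrite -[euler R 5]/(euler R (5 * 1)) -dil_euler // cube2.
rewrite pentagonal2 dil_gsum // gsumM //.
pose h (p : int * int) : int * int := let: (l, r) := p in
  (if evenz l then ((3 * l - 4 * r) %/ 2)%Z else ((4 * r - 3 * l - 1) %/ 2)%Z, l).
pose g (p : int * int) : int * int := let: (i, l) := p in
  (l, if evenz l then ((3 * l - 2 * i) %/ 4)%Z else ((3 * l + 1 + 2 * i) %/ 4)%Z).
pose E (p : int * int) := (texp 4 3 p.1 + 5 * texp 3 2 p.2)%N.
(* The half exponent, divided by 2 rather than given by its formula because the
   latter is a difference of natural numbers. *)
pose D p := (E (h p))./2.
have hK : cancel h g.
  case=> l r; rewrite /g /h.
  by case: (boolP (evenz l)); rewrite /evenz => ?; congr (_, _); lia.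
have e_h l r : (E (h (l, r)))%:Z
    = 2 * (6 * (l * l) + 2 * l - 6 * (l * r) - r + 4 * (r * r)).
  rewrite /E /h /= PoszD PoszM texp43; have := texp32 l.
  case: (boolP (evenz l)) => [/evenzP[m ->]|].
    have -> : ((3 * (2 * m) - 4 * r) %/ 2)%Z = 3 * m - 2 * r by lia.
    by lia.
  case/oddz_ex=> m ->.
  have -> : ((4 * r - 3 * (2 * m + 1) - 1) %/ 2)%Z = 2 * r - 3 * m - 2 by lia.
  by lia.
have D2 p : E (h p) = (2 * D p + 0)%N.
  by case: p => l r; rewrite /D; have := e_h l r; lia.
have De l r : (D (l, r))%:Z = 6 * (l * l) + 2 * l - 6 * (l * r) - r + 4 * (r * r).
  by have := e_h l r; rewrite D2; lia.
rewrite (@gsum_sec _ _ _ h g hK _ D) //; last first.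
  case=> i l /= e2; rewrite /h /g.
  have := texp43 i; have := texp32 l; move: e2.
  case: (boolP (evenz l)) => [/evenzP[m ->]|].
    by move=> e2 e3 e4; congr (_, _); move: e2 e3 e4; lia.
  case/oddz_ex=> m ->.
  by move=> e2 e3 e4; congr (_, _); move: e2 e3 e4; lia.
pose sigma (p : int * int) := (p.1 - p.2, - p.2).
have finD : finfib D.
  by apply: (finfib_pull hK _ D2) => //; exact: (finfib_pair fin4 fin5).
have -> : gsum D ((fun p => 1 * 1) \o h) = gsum D (fun=> 1) :> pser R.
  by apply: eq_gsum => // p; rewrite /= mulr1.
rewrite (@gsum_involution _ D sigma (fun p => (0 < p.2)%R)) //.
- rewrite (@gsum_pull _ _ _ (fun l : int => (l, 0 : int)) fst _ D (texp 3 2) _ 4 0) //.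
  + rewrite expr0 mul1r.
    have -> : gsum (texp 3 2)
                ((fun p => (sigma p == p)%:R) \o (fun l : int => (l, 0 : int)))
       = euler R 1.
      rewrite pentagonal2; apply: eq_gsum => // l.
      by rewrite /= /sigma /= subr0 oppr0 eqxx.
    by rewrite dil_euler.
  + by move=> l; have := De l 0; have := texp32 l; lia.
  case=> l r; rewrite /sigma xpair_eqE /=; case: (eqVneq r 0) => [->//|r0].
  by rewrite (_ : (- r == r) = false) ?andbF ?eqxx //; lia.
- by case=> l r; rewrite /sigma /=; congr (_, _); lia.
- by case=> l r; have := De l r; have := De (l - r) (- r); rewrite /sigma /=; lia.
case=> l r; rewrite /sigma /= xpair_eqE; lia.
Qed.

(** The same method for f_1 f_5^3: multiplied by 24, and with 16 added, its
    exponents are the values of x^2 + 15 y^2, which has the involutive isometry (x, y) -> ((x + 15 y) / 4, (x - y) / 4).  With x = 6 l + 1 and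
    y = x - 4 t, it exchanges t and x - 4 t, and t has the parity of the
    exponent; for t = 2 r + 1 it reads
    (l, r) -> (4 l - 5 r - 2, 3 l - 4 r - 2).  The fixed points are the
    (- 5 u - 1, - 3 u - 1). *)
Lemma sec1_pentagonal_cube :
  sec 2 1 (euler R 1 * euler R 5 ^+ 3) = euler R 20.
Proof.
have fin3 := @finfib_texp 3 2 isT isT; have fin4 := @finfib_texp 4 3 isT isT.
have fin5 := finfib_scale (isT : 0 < 5)%N fin4.
rewrite -[euler R 5]/(euler R (5 * 1)) -dil_euler // -rmorphXn /= cube2.
rewrite pentagonal2 dil_gsum // gsumM //.
pose h (p : int * int) : int * int := let: (l, r) := p in
  (l, if evenz l then ((3 * l - 4 * r - 2) %/ 2)%Z else ((4 * r - 3 * l + 1) %/ 2)%Z).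
pose g (p : int * int) : int * int := let: (l, i) := p in
  (l, if evenz l then ((3 * l - 2 * i - 2) %/ 4)%Z else ((3 * l - 1 + 2 * i) %/ 4)%Z).
pose E (p : int * int) := (texp 3 2 p.1 + 5 * texp 4 3 p.2)%N.
pose D p := (E (h p))./2.
have hK : cancel h g.
  case=> l r; rewrite /g /h.
  by case: (boolP (evenz l)); rewrite /evenz => ?; congr (_, _); lia.
have e_h l r : (E (h (l, r)))%:Z
    = 2 * (12 * (l * l) - 11 * l - 30 * (l * r) + 15 * r + 20 * (r * r) + 2) + 1.
  rewrite /E /h /= PoszD PoszM texp43; have := texp32 l.
  case: (boolP (evenz l)) => [/evenzP[m ->]|].
    have -> : ((3 * (2 * m) - 4 * r - 2) %/ 2)%Z = 3 * m - 2 * r - 1 by lia.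
    by lia.
  case/oddz_ex=> m ->.
  have -> : ((4 * r - 3 * (2 * m + 1) + 1) %/ 2)%Z = 2 * r - 3 * m - 1 by lia.
  by lia.
have D2 p : E (h p) = (2 * D p + 1)%N.
  by case: p => l r; rewrite /D; have := e_h l r; lia.
have De l r : (D (l, r))%:Z
    = 12 * (l * l) - 11 * l - 30 * (l * r) + 15 * r + 20 * (r * r) + 2.
  by have := e_h l r; rewrite D2; lia.
rewrite (@gsum_sec _ _ _ h g hK _ D) //; last first.
  case=> l i /= e2; rewrite /h /g.
  have := texp43 i; have := texp32 l; move: e2.
  case: (boolP (evenz l)) => [/evenzP[m ->]|].
    by move=> e2 e3 e4; congr (_, _); move: e2 e3 e4; lia.
  case/oddz_ex=> m ->.
  by move=> e2 e3 e4; congr (_, _); move: e2 e3 e4; lia.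
pose sigma (p : int * int) := (4 * p.1 - 5 * p.2 - 2, 3 * p.1 - 4 * p.2 - 2).
have finD : finfib D.
  by apply: (finfib_pull hK _ D2) => //; exact: (finfib_pair fin3 fin5).
have -> : gsum D ((fun p => 1 * 1) \o h) = gsum D (fun=> 1) :> pser R.
  by apply: eq_gsum => // p; rewrite /= mulr1.
rewrite (@gsum_involution _ D sigma (fun p => (p.2 < 3 * p.1 - 4 * p.2 - 2)%R)) //.
- rewrite (@gsum_pull _ _ _ (fun u : int => (- (5 * u) - 1, - (3 * u) - 1))
      (fun p => p.1 - 2 * p.2 - 1) _ D (texp 3 2) _ 20 0) //.
  + rewrite expr0 mul1r.
    have -> : gsum (texp 3 2) ((fun p => (sigma p == p)%:R) \o
         (fun u : int => (- (5 * u) - 1, - (3 * u) - 1))) = euler R 1.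
      rewrite pentagonal2; apply: eq_gsum => // u.
      by rewrite /= /sigma xpair_eqE /= (_ : _ && _ = true) //; lia.
    by rewrite dil_euler.
  + by move=> u /=; lia.
  + move=> u /=; have := De (- (5 * u) - 1) (- (3 * u) - 1); have := texp32 u; lia.
  case=> l r; rewrite /sigma xpair_eqE /=.
  case: (eqVneq (4 * l - 5 * r - 2) l) => /= [e1 _|_]; last by rewrite eqxx.
  by congr (_, _); lia.
- by case=> l r; rewrite /sigma /=; congr (_, _); lia.
- by case=> l r; have := De l r; have := De (4 * l - 5 * r - 2) (3 * l - 4 * r - 2);
     rewrite /sigma /=; lia.
case=> l r; rewrite /sigma /= xpair_eqE; lia.
Qed.
End CharTwo.

(** * The 5-regular bipartition function *)

Lemma eulerV : (fps_div (psC 1) (euler int 1) : pser int) * euler int 1 = 1.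
Proof.
apply/funext => n; have := @fps_divK (psC 1) (euler int 1); apply.
by rewrite euler0 ?unitr1.
Qed.

Definition reg5 : pser int := euler int 5 * fps_div (psC 1) (euler int 1).

Lemma reg5E : reg5 * euler int 1 = euler int 5.
Proof. by rewrite /reg5 -mulrA eulerV mulr1. Qed.

Lemma B5_euler : (B5 : pser int) * euler int 1 ^+ 2 = euler int 5 ^+ 2.
Proof.
by apply/funext => n; rewrite -!qpoch_euler; apply: B5_genfun.
Qed.

Lemma B5_sqr : B5 = reg5 ^+ 2 :> pser int.
Proof.
apply: (@pser_mulI _ (euler int 1 ^+ 2)).
  by rewrite expr2 coefpsM big_ord1 euler0 // mulr1.
by rewrite mulrC B5_euler -reg5E; ring.
Qed.

Lemma pchar_Fp2 : 2 \in [pchar 'F_2]. Proof. exact: pchar_Fp. Qed.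
Lemma pchar_Fp5 : 5 \in [pchar 'F_5]. Proof. exact: pchar_Fp. Qed.

(** Over F_2 the sections a and b of g are read off
    f_1^3 f_5 = f_4 g and f_1 f_5^3 g(q^2) = f_20 g, in which f_4, f_20 and g(q^2)
    are series in q^2. *)
Lemma sec_reg5_mod2 :
  smap (intr : int -> 'F_2) (sec 2 0 reg5 * sec 2 1 reg5) =
  euler 'F_2 1 * euler 'F_2 5 ^+ 3.
Proof.
set phi := (intr : int -> 'F_2).
pose G := smap phi reg5; pose a := sec 2 0 G; pose b := sec 2 1 G.
have GE : G * euler 'F_2 1 = euler 'F_2 5.
  by rewrite -!(smap_euler (intr : {rmorphism int -> 'F_2})) -rmorphM /= reg5E.
have frob k : (0 < k)%N -> euler 'F_2 k ^+ 2 = euler 'F_2 (2 * k).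
  exact: euler_pchar pchar_Fp2.
have e2 : euler 'F_2 2 = euler 'F_2 1 ^+ 2 by rewrite frob.
have e4 : euler 'F_2 4 = euler 'F_2 2 ^+ 2 by rewrite frob.
have e10 : euler 'F_2 10 = euler 'F_2 5 ^+ 2 by rewrite frob.
have e20 : euler 'F_2 20 = euler 'F_2 10 ^+ 2 by rewrite frob.
have ea : a = euler 'F_2 2.
  apply: (@pser_mulI _ (euler 'F_2 2)); first exact: euler0.
  rewrite -expr2 -e4 -(sec0_cube_pentagonal pchar_Fp2) -GE.
  have -> : euler 'F_2 1 ^+ 3 * (G * euler 'F_2 1) = dil 2 (euler 'F_2 2) * G.
    by rewrite dil_euler // -[(2 * 2)%N]/4%N e4 e2; ring.
  by rewrite sec_dilM.
have G2 : G ^+ 2 = dil 2 G.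
  apply: (@pser_mulI _ (euler 'F_2 2)); first exact: euler0.
  have -> : euler 'F_2 2 * dil 2 G = dil 2 (G * euler 'F_2 1).
    by rewrite rmorphM /= dil_euler // mulrC.
  by rewrite GE dil_euler // -[(2 * 5)%N]/10%N e10 -GE e2; ring.
have eb : b = euler 'F_2 10 * G.
  apply: (@pser_mulI _ (euler 'F_2 10)); first exact: euler0.
  rewrite mulrA -expr2 -e20 -(sec1_pentagonal_cube pchar_Fp2).
  transitivity (sec 2 1 (dil 2 (euler 'F_2 10) * G)); first by rewrite sec_dilM.
  have -> : dil 2 (euler 'F_2 10) * G = dil 2 G * (euler 'F_2 1 * euler 'F_2 5 ^+ 3).
    by rewrite dil_euler // -[(2 * 10)%N]/20%N -G2 e20 e10 -GE; ring.
  by rewrite sec_dilM // mulrC.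
transitivity (a * b); first exact: rmorphM.
by rewrite ea eb e2 e10 -GE; ring.
Qed.

Lemma B5_odd k : B5 (2 * k + 1)%N = 2 * (sec 2 0 reg5 * sec 2 1 reg5) k.
Proof.
rewrite B5_sqr -[LHS]/(sec 2 1 (reg5 ^+ 2) k) sec_sqr.
by rewrite mulr_natl coefpsMn mulr_natl.
Qed.

Lemma euler5_mod5 :
  exists h : pser int, euler int 5 = euler int 1 ^+ 5 + 5%:R * h.
Proof.
pose d := euler int 5 - euler int 1 ^+ 5.
have d0 : smap (intr : int -> 'F_5) d = 0.
  rewrite rmorphB rmorphXn /= !smap_euler (euler_pchar pchar_Fp5) //.
  exact: subrr.
exists (fun n => (d n %/ 5)%Z); rewrite -[LHS](subrK (euler int 1 ^+ 5)) addrC -/d.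
congr (_ + _); apply/funext => n.
have : (5 %| d n)%Z.
  by rewrite (dvdz_pcharf pchar_Fp5); have /eqP := congr1 (@^~ n) d0.
by rewrite mulr_natl coefpsMn -mulr_natl; lia.
Qed.

(** The odd part of f_1^8 is a multiple of q f_4^8. *)
Lemma euler8_4n3 n : (euler int 1 ^+ 8) (4 * n + 3)%N = 0.
Proof.
have := congr1 (@^~ (2 * n + 1)%N) (sec_euler8 int).
rewrite mulr_natl coefpsMn coefpsN mulr_natl coefpsMn.
have -> : (euler int 2 ^+ 8) (2 * n + 1)%N = 0.
  rewrite -[euler int 2]/(euler int (2 * 1)) -dil_euler // -rmorphXn /= coef_dil //.
  by rewrite dvdn_addr ?dvdn_mulr.
rewrite mul0rn oppr0 /sec => /eqP; rewrite Num.Theory.mulrn_eq0 => /eqP <-.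
by congr (_ _); lia.
Qed.

Lemma sec5_cube_euler5 (R : comNzRingType) r : (r < 5)%N ->
  sec 5 r (euler R 1 ^+ 3 * euler R 5) = euler R 1 * sec 5 r (euler R 1 ^+ 3).
Proof.
by move=> ltr5; rewrite mulrC -[euler R 5]/(euler R (5 * 1)) -dil_euler // sec_dilM.
Qed.

(** The square of h / f_1, where f_5 = f_1^5 + 5 h, is the error term. *)
Lemma B5_mod25 : exists k : pser int,
  B5 = 2%:R * (euler int 1 ^+ 3 * euler int 5) - euler int 1 ^+ 8 + 25%:R * k
  :> pser int.
Proof.
have [h eh] := euler5_mod5.
pose u : pser int := fps_div (psC 1) (euler int 1).
have eu : u * euler int 1 = 1 by exact: eulerV.
exists ((h * u) ^+ 2); rewrite B5_sqr /reg5 -/u eh.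
have eX m : euler int 1 ^+ m = euler int 1 ^+ m * (u * euler int 1) ^+ 2.
  by rewrite eu expr1n mulr1.
by rewrite [euler int 1 ^+ 8]eX [euler int 1 ^+ 3]eX; ring.
Qed.

Lemma B5_euler8_mod5 : exists k : pser int, B5 = euler int 1 ^+ 8 + 5%:R * k :> pser int.
Proof.
have [k ->] := B5_mod25; have [h eh] := euler5_mod5.
by exists (2%:R * (euler int 1 ^+ 3 * h) + 5%:R * k); rewrite eh; ring.
Qed.

Lemma B5_even k : (2 %| B5 (2 * k + 1)%N)%Z.
Proof. by rewrite B5_odd dvdz_mulr. Qed.

Lemma B5_dvd4 k r : (r == 3%N) || (r == 4%N) -> (4 %| B5 (2 * (5 * k + r) + 1)%N)%Z.
Proof.
move=> r34; rewrite B5_odd -[4]/(2 * 2 : int) dvdz_mul2l //.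
rewrite (dvdz_pcharf pchar_Fp2) -[_%:~R]/(smap (intr : int -> 'F_2) _ _).
rewrite sec_reg5_mod2 -[euler _ 5]/(euler _ (5 * 1)) -dil_euler // -rmorphXn /= mulrC.
rewrite -[X in X == 0]/(sec 5 r (dil 5 (euler 'F_2 1 ^+ 3) * euler 'F_2 1) k).
rewrite sec_dilM; last by lia.
by rewrite sec5_pentagonal // mulr0.
Qed.

Theorem theorem3p11 (n : nat) :
  (B5 (4 * n + 3)%N = 0 %[mod 10])%Z /\
  ((B5 (5 * n + 2)%N = 0 %[mod 5])%Z /\
   (B5 (5 * n + 3)%N = 0 %[mod 5])%Z /\
   (B5 (5 * n + 4)%N = 0 %[mod 5])%Z) /\
  ((B5 (20 * n + 7)%N = 0 %[mod 100])%Z /\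
   (B5 (20 * n + 19)%N = 0 %[mod 100])%Z).
Proof.
have [k5 eB5] := B5_euler8_mod5; have [k25 eB25] := B5_mod25.
have dvd5 m : (1 < m < 5)%N -> (5 %| B5 (5 * n + m)%N)%Z.
  move=> m_bnd; have ltm5 : (m < 5)%N by case/andP: m_bnd.
  have e : euler 'F_5 1 ^+ 8 = euler 'F_5 1 ^+ 3 * euler 'F_5 5.
    by rewrite -[euler _ 5]/(euler _ (5 * 1)) -(euler_pchar pchar_Fp5) // -exprD.
  have e8 : (5 %| (euler int 1 ^+ 8) (5 * n + m)%N)%Z.
    rewrite (dvdz_pcharf pchar_Fp5) -[_%:~R]/(smap (intr : int -> 'F_5) _ _).
    rewrite rmorphXn /= smap_euler e -[X in X == 0]/(sec 5 m _ n).
    by rewrite sec5_cube_euler5 // sec5_cube_F5 // mulr0.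
  by rewrite eB5 coefpsD mulr_natl coefpsMn -[_ *+ 5]mulr_natl; lia.
have dvd25 m r : (m = 5 * (m %/ 5) + r)%N -> (r == 2%N) || (r == 4%N) ->
    (euler int 1 ^+ 8) m = 0 -> (25 %| B5 m)%Z.
  move=> em r24 e8; have ltr5 : (r < 5)%N by lia.
  rewrite eB25 coefpsD coefpsB e8 subr0 !mulr_natl !coefpsMn em.
  have := congr1 (@^~ (m %/ 5)%N) (sec5_cube_euler5 int ltr5).
  rewrite (sec5_cube_int r24) mulr0 {1}/sec => ->.
  by rewrite mul0rn add0r -[_ *+ 25]mulr_natl; lia.
have dvd100 (x : int) : (4 %| x)%Z -> (25 %| x)%Z -> (x = 0 %[mod 100])%Z by lia.
split; last split.
- have d2 : (2 %| B5 (4 * n + 3)%N)%Z.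
    by have -> : (4 * n + 3 = 2 * (2 * n + 1) + 1)%N by [lia]; apply: B5_even.
  have d5 : (5 %| B5 (4 * n + 3)%N)%Z.
    by rewrite eB5 coefpsD euler8_4n3 add0r mulr_natl coefpsMn -[_ *+ 5]mulr_natl; lia.
  by move: (B5 _) d2 d5 => x; lia.
- have d2 := dvd5 2%N isT; have d3 := dvd5 3%N isT; have d4 := dvd5 4%N isT.
  by move: (B5 _) (B5 _) (B5 _) d2 d3 d4 => x y z; lia.
split; apply: dvd100.
- by have -> : (20 * n + 7 = 2 * (5 * (2 * n) + 3) + 1)%N; [lia|apply: B5_dvd4].
- apply: (@dvd25 _ 2) => //; first lia.
  by have -> : (20 * n + 7 = 4 * (5 * n + 1) + 3)%N; [lia|apply: euler8_4n3].
- by have -> : (20 * n + 19 = 2 * (5 * (2 * n + 1) + 4) + 1)%N; [lia|apply: B5_dvd4].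
- apply: (@dvd25 _ 4) => //; first lia.
  by have -> : (20 * n + 19 = 4 * (5 * n + 4) + 3)%N; [lia|apply: euler8_4n3].
Qed.
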